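(* Let $q$ be a prime power and $h \in \mathbb{F}_q$, $h \neq 0$. Let \[ \pi(3,q;(0,h)) = \#\{f \in \mathbb{F}_q[T] \text{ monic of degree } 3 \ : \ f \text{ and } f+h \text{ are both irreducible in } \mathbb{F}_q[T]\}. \] Then \[ \pi(3,q;(0,h)) = \frac{1}{9} q^3 \cdot \begin{cases} 1 - q^{-1} - 3q^{-2} & \text{if } q \equiv 0 \pmod 3,\\[1ex] 1 + \left(c^2_q - 3\right) q^{-1} -2q^{-2} & \text{if } q \equiv 1 \pmod 3 \text{ and } h \text{ is a cube in } \mathbb{F}_q,\\[1ex] 1 + c_q \, c_{q,h}\, q^{-1} - 8q^{-2} & \text{if } q \equiv 1 \pmod 3 \text{ and } h \text{ is not a cube in } \mathbb{F}_q,\\[1ex] 1 - q^{-1} - 2q^{-2} & \text{if } q \equiv 2 \pmod 3. \end{cases} \]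
   Context: For $3 \nmid q$: $\mathscr{E}$ is the elliptic curve over $\mathbb{F}_q$ given by (the projective closure of) $X^3 = Y(Y-1)$, and for $h \in \mathbb{F}_q^\times$, $\mathscr{E}_h$ is its cubic twist given by $hX^3 = Y(Y-1)$. Set $c_q := \frac{1+q-\#\mathscr{E}(\mathbb{F}_q)}{\sqrt q}$ and $c_{q,h} := \frac{1+q-\#\mathscr{E}_h(\mathbb{F}_q)}{\sqrt q}$, where $\#$ counts $\mathbb{F}_q$-rational points of the smooth projective curves. *)

(* Defs.v *)
From HB Require Import structures.
From mathcomp Require Export all_boot all_order all_algebra all_field.

Set Implicit Arguments.
Unset Strict Implicit.
Unset Printing Implicit Defensive.

Import GRing.Theory Num.Theory.
Local Open Scope ring_scope.

(* pi(n, q; (0, h)). The type {poly_n.+1 F} contains every polynomial of degree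
   n; [irreducibleb] decides [irreducible_poly], see [irreducibleP]. *)
Definition prime_pair_count (F : finFieldType) (n : nat) (h : F) : nat :=
  #|[set f : {poly_n.+1 F} |
      [&& (f : {poly F}) \is monic, size (f : {poly F}) == n.+1,
          irreducibleb (f : {poly F}) & irreducibleb ((f : {poly F}) + h%:P)]]|.

(* The point (x : y : z) of P^2(F), as the set of its homogeneous coordinates
   when v = (x, y, z) is nonzero. *)
Definition proj_point (F : finFieldType) (v : 'rV[F]_3) : {set 'rV[F]_3} :=
  [set a *: v | a : F & a != 0].

(* The F-points of the projective closure, h X^3 = Y (Y - Z) Z, of the affine
   curve h X^3 = Y (Y - 1). This plane cubic is smooth when h != 0 and the
   characteristic is not 3. *)
Definition cubic_twist (F : finFieldType) (h : F) : {set {set 'rV[F]_3}} :=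
  [set proj_point v | v : 'rV[F]_3 &
    let x := v 0 0 in let y := v 0 1 in let z := v 0 2 in
    (v != 0) && (h * x ^+ 3 == y * (y - z) * z)].

Definition cqh (R : rcfType) (F : finFieldType) (h : F) : R :=
  (1 + #|F|%:R - #|cubic_twist h|%:R) / Num.sqrt #|F|%:R.

Definition cq (R : rcfType) (F : finFieldType) : R := cqh R (1 : F).

Definition is_cube (F : finFieldType) (h : F) : Prop := exists x : F, h = x ^+ 3.

(* Main.v *)
From mathcomp Require Import ring zify cyclic pgroup abelian.
Require Import Defs.

(* Completing the cube reduces to counting the pairs (t, c) for which both
   T^3 - 3tT - c and T^3 - 3tT - (c + h) have no root (characteristic <> 3).
   By Cardano, such a root x = u + t / u gives a cube a = u^3 that is a root of
   the resolvent Z^2 - cZ + t^3, and conversely x makes every root of the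
   resolvent a cube. So a non-cube root of the resolvent, in F when q = 1 mod 3
   and in F_{q^2} \ F when q = 2 mod 3, certifies irreducibility; as there are
   only (q^2 - 1) / 3 rootless pairs (t, c), each one arises, and from two
   roots unless t = 0.
   The count becomes a sum over pairs (a, b) of non-cubes. If q = 1 mod 3, the
   substitution b = d y, a = d (y - 1) splits it into products of cubic Jacobi
   sums, which are also the traces of the cubic twists. If q = 2 mod 3, a and b
   have equal norm, and b = a u with u of norm 1 splits it into a sum over the
   norm-1 group and a sum over the elements of trace h.
   In characteristic 3, T^3 - s^2 T + c and T^3 + aT^2 - a^3 m^2 have no root iff
   c / s^3, respectively m, is not of the form x^3 - x, and all other cubics
   T^3 + bT + c and T^3 + aT^2 + c have one. *)

Set Implicit Arguments.
Unset Strict Implicit.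
Unset Printing Implicit Defensive.

Import GRing.Theory Num.Theory.
Local Open Scope ring_scope.

(** * Monic cubics without roots *)

Section MonicCubics.

Variable F : finFieldType.
Implicit Types a b c h s t x y : F.

Definition cubic a b c x : F := x ^+ 3 + a * x ^+ 2 + b * x + c.

Definition rootless a b c : bool := [forall x, cubic a b c x != 0].

Definition rootless_pairs h a b : nat :=
  (\sum_c (rootless a b c && rootless a b (c + h)%R))%N.

Lemma rootless_shift s a b c :
  rootless (a + s *+ 3) (b + (a * s) *+ 2 + s ^+ 2 *+ 3) (cubic a b c s)
    = rootless a b c.
Proof.
have E x : cubic (a + s *+ 3) (b + (a * s) *+ 2 + s ^+ 2 *+ 3) (cubic a b c s) x
             = cubic a b c (x + s) by rewrite /cubic; ring.
apply/forallP/forallP => H x; last by rewrite E; exact: H.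
by rewrite -[x](subrK s) -E; exact: H.
Qed.

(** Translating x by [s] moves the constant term by [cubic a b 0 s], whatever [c] is; re-indexing
    [c] absorbs this and keeps the gap [h]. *)
Lemma rootless_pairs_shift s h a b :
  rootless_pairs h (a + s *+ 3) (b + (a * s) *+ 2 + s ^+ 2 *+ 3)
    = rootless_pairs h a b.
Proof.
rewrite /rootless_pairs (reindex_inj (addIr (cubic a b 0 s))) /=.
apply: eq_bigr => c _; rewrite -(rootless_shift s a b c).
rewrite -(rootless_shift s a b (c + h)).
by congr (nat_of_bool (rootless _ _ _ && rootless _ _ _)); rewrite /cubic; ring.
Qed.

Let pol a b c : {poly F} := Poly [:: c; b; a; 1].

Let polE a b c : pol a b c = [:: c; b; a; 1] :> seq F.
Proof. by apply: (@PolyK _ 0); rewrite /= oner_eq0. Qed.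

Let size_pol a b c : size (pol a b c) = 4.
Proof. by rewrite polE. Qed.

Let horner_pol a b c x : (pol a b c).[x] = cubic a b c x.
Proof. by rewrite /pol horner_Poly /= /cubic; ring. Qed.

Let irreducible_pol a b c : irreducibleb (pol a b c) = rootless a b c.
Proof.
apply/irreducibleP/forallP => [[_ irr] x | H].
  apply/negP => /eqP x0.
  have dv : 'X - x%:P %| pol a b c by rewrite dvdp_XsubCl /root horner_pol x0.
  have /eqp_size : 'X - x%:P %= pol a b c by apply: irr; rewrite ?size_XsubC.
  by rewrite size_XsubC size_pol.
apply: cubic_irreducible; first by rewrite size_pol.
by move=> x; rewrite /root horner_pol.
Qed.

Let pol_addC a b c h : pol a b c + h%:P = pol a b (c + h).
Proof.
apply/polyP => i; rewrite coefD coefC !coef_Poly.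
by case: i => [|[|[|[|i]]]] //=; rewrite ?addr0 // nth_nil addr0.
Qed.

Lemma prime_pair_count3E h :
  prime_pair_count 3 h = (\sum_a \sum_b rootless_pairs h a b)%N.
Proof.
pose D := [set u : F * F * F |
  rootless u.1.1 u.1.2 u.2 && rootless u.1.1 u.1.2 (u.2 + h)].
pose g (u : F * F * F) := npolyp 4 (pol u.1.1 u.1.2 u.2).
have gE u : g u = pol u.1.1 u.1.2 u.2 :> {poly F}.
  by rewrite npolypK // size_pol.
have inj_g : injective g.
  move=> [[a b] c] [[a' b'] c'] /(congr1 (fun p : {poly_4 F} => polyseq p)).
  by rewrite !gE /= !polE => -[-> -> ->].
have -> : prime_pair_count 3 h = #|D|.
  rewrite -(card_imset _ inj_g) /prime_pair_count; congr #|pred_of_set _|.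
  apply/setP => f; rewrite inE; apply/and4P/imsetP => [[mf /eqP sf if1 if2]|].
    have fE : val f = pol f`_2 f`_1 f`_0.
      apply/polyP => i; rewrite coef_Poly.
      case: i => [|[|[|[|i]]]] //=; last by rewrite nth_nil nth_default // sf.
      by move/eqP: mf; rewrite lead_coefE sf.
    exists (f`_2, f`_1, f`_0); last by apply/val_inj; rewrite /= gE.
    by rewrite inE /= -!irreducible_pol -pol_addC -fE if1.
  case=> -[[a b] c]; rewrite inE /= => /andP[r1 r2] ->; rewrite gE /=.
  by rewrite pol_addC !irreducible_pol monicE lead_coefE polE; split.
rewrite /rootless_pairs (pair_bigA _ (fun a b => \sum_c _)%N) pair_bigA /=.
rewrite -sum1_card big_mkcond.
by apply: eq_bigr => u _; rewrite inE; case: ifP.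
Qed.

End MonicCubics.

(** * Delta sums, and depressed cubics in characteristic other than 3 *)

Lemma sum_delta (R : pzSemiRingType) (T : finType) (k : T) (G : T -> R) :
  \sum_c (k == c)%:R * G c = G k.
Proof.
rewrite (bigD1 k) //= eqxx mul1r big1 ?addr0 // => c /negPf.
by rewrite eq_sym => ->; rewrite mul0r.
Qed.

Lemma sum_deltan (T : finType) (k : T) : (\sum_c (k == c) = 1)%N.
Proof. by rewrite (bigD1 k) //= eqxx big1 ?addn0 // => c /negPf;
  rewrite eq_sym => ->. Qed.

Section DepressedCubics.

Variable F : finFieldType.
Hypothesis nz3 : 3%:R != 0 :> F.
Implicit Types a b c h s t x y : F.

(** The factor 3 keeps Cardano's resolvent Z^2 - cZ + t^3 free of denominators. *)
Definition noroot t c : bool := [forall x, x ^+ 3 - (t * x) *+ 3 != c].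

Definition noroot_pairs h : nat :=
  (\sum_t \sum_c (noroot t c && noroot t (c + h)%R))%N.

Lemma prime_pair_count_depressed h :
  prime_pair_count 3 h = (#|F| * noroot_pairs h)%N.
Proof.
rewrite prime_pair_count3E -sum_nat_const; apply: eq_bigr => a _.
have aE : a = 0 + (a / 3%:R) *+ 3 by rewrite add0r -mulr_natr divfK.
pose s := a / 3%:R.
rewrite (reindex_inj (addIr (s ^+ 2 *+ 3))) /=.
have injm3 : injective (fun t : F => - (t *+ 3)).
  by move=> t u /oppr_inj; rewrite -(mulr_natr t) -(mulr_natr u); apply: mulIf.
rewrite (reindex_inj injm3) /=; apply: eq_bigr => t _.
have -> : rootless_pairs h a (- (t *+ 3) + s ^+ 2 *+ 3)
  = rootless_pairs h 0 (- (t *+ 3)).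
  rewrite -(rootless_pairs_shift s h 0); congr rootless_pairs => //.
  by rewrite mul0r mul0rn addr0.
have E c : rootless 0 (- (t *+ 3)) (- c) = noroot t c.
  by apply: eq_forallb => x; rewrite -[in RHS]subr_eq0; congr (~~ (_ == 0));
    rewrite /cubic; ring.
(* [noroot t c] concerns the constant term -c, so c -> -h - c exchanges the two conditions of the
   pair. *)
rewrite /rootless_pairs (reindex_inj (inv_inj (subKr (- h)))) /=.
apply: eq_bigr => c _; rewrite -!E andbC [- (c + h)]opprD [- c - h]addrC.
by rewrite [- h - c + h]addrAC addNr add0r.
Qed.

Let r t c : nat := (\sum_x (x ^+ 3 - (t * x) *+ 3 == c)%R)%N.

Let sum_r : (\sum_t \sum_c r t c = #|F| ^ 2)%N.
Proof.
rewrite (eq_bigr (fun=> #|F|)) ?sum_nat_const ?mulnn // => t _.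
rewrite exchange_big /= (eq_bigr (fun=> 1%N)) ?sum1_card // => x _.
exact: sum_deltan.
Qed.

(** The difference is (x - y)(x^2 + xy + y^2 - 3t), so distinct [x] and [y] collide for exactly one
    [t]. *)
Let same_value x y t : (x ^+ 3 - (t * x) *+ 3 == y ^+ 3 - (t * y) *+ 3)
  = (x == y) || ((x ^+ 2 + x * y + y ^+ 2) / 3%:R == t).
Proof.
rewrite -subr_eq0 -[x == y]subr_eq0 (can2_eq (divfK nz3) (mulfK nz3)).
rewrite -[X in _ || X]subr_eq0 -mulf_eq0; congr (_ == 0); ring.
Qed.

(** The second moment counts triples (t, x, y) with equal values at [x] and [y]: q choices of [t]
    when x = y, one otherwise. *)
Let sum_r2 : (\sum_t \sum_c r t c ^ 2 = #|F| * (#|F| + #|F|.-1))%N.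
Proof.
transitivity (\sum_(x : F) \sum_(y : F) if x == y then #|F| else 1)%N.
  transitivity (\sum_t \sum_x \sum_(y : F)
      (x ^+ 3 - (t * x) *+ 3 == y ^+ 3 - (t * y) *+ 3)%R)%N.
    apply: eq_bigr => t _.
    under eq_bigr => c _.
      rewrite -mulnn /r big_distrlr /=.
    over.
    rewrite exchange_big /=; apply: eq_bigr => x _.
    rewrite exchange_big /=; apply: eq_bigr => y _.
    rewrite (bigD1 (x ^+ 3 - (t * x) *+ 3)) //= eqxx mul1n big1 ?addn0 1?eq_sym
      //.
    by move=> c /negPf; rewrite eq_sym => ->.
  rewrite exchange_big /=; apply: eq_bigr => x _.
  rewrite exchange_big /=; apply: eq_bigr => y _.
  under eq_bigr => t _ do rewrite same_value.
  by case: eqVneq => _ /=; [rewrite sum1_card | rewrite sum_deltan].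
rewrite (eq_bigr (fun=> #|F| + #|F|.-1)%N) ?sum_nat_const // => x _.
rewrite (bigD1 x) //= eqxx; congr addn.
rewrite (eq_bigr (fun=> 1%N)) ?sum1_card; last first.
  by move=> y /negPf; rewrite eq_sym => ->.
by rewrite cardC1.
Qed.

(** T^3 - 3x^2 T + 2x^3 = (T - x)^2 (T + 2x): these are the parameters of a cubic with a double
    root. *)
Let dbl x : F * F := (x ^+ 2, - (x ^+ 3 *+ 2)).

(** The polynomial r^2 - 4r + 3 = (r - 1)(r - 3) is 3 at r = 0, vanishes at 1 and 3, and is negative
    only at r = 2, where it is -1. Exactly two roots force a double root, which the last term pays
    for. *)
Let r_pointwise t c :
  (3 * noroot t c + 4 * r t c
     <= r t c ^ 2 + 3 + ((t, c) \in [set dbl x | x in [set~ 0%R]]))%N.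
Proof.
have nE : noroot t c = (r t c == 0)%N.
  rewrite /r sum_nat_eq0; apply: eq_forallb => x /=.
  by rewrite eqb0.
case: (ltngtP (r t c) 2) => [r1|r1|r2].
- by rewrite nE; move: r1; case: (r t c) => [|[|?]] //=; lia.
- rewrite nE; nia.
suff -> : (t, c) \in [set dbl x | x in [set~ 0%R]] by rewrite nE; nia.
have : #|[set x | x ^+ 3 - (t * x) *+ 3 == c]| == 2.
  apply/eqP; rewrite -[RHS]r2 -sum1_card big_mkcond /r.
  by apply: eq_bigr => x _; rewrite inE; case: ifP.
case/cards2P => x [y [nxy E]].
have rt z : (z ^+ 3 - (t * z) *+ 3 == c) = (z == x) || (z == y).
  by have := in_set2 z x y; rewrite -E inE.
have /eqP rx := rt x; have /eqP ry := rt y.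
rewrite eqxx /= in rx; rewrite eqxx orbT in ry.
have := same_value x y t; rewrite rx ry eqxx (negPf nxy) /= => /esym/eqP tE.
have t3 : t *+ 3 = x ^+ 2 + x * y + y ^+ 2 by rewrite -tE -[LHS]mulr_natr divfK.
have cE : c = - (x * y * (x + y)).
  by rewrite -rx -mulrnAl t3; ring.
have dblP u v : v = - u *+ 2 -> u != v -> t *+ 3 = u ^+ 2 + u * v + v ^+ 2 ->
    c = - (u * v * (u + v)) -> (t, c) \in [set dbl x | x in [set~ 0%R]].
  move=> -> nuv tu cu; apply/imsetP; exists u.
    by rewrite !inE; apply: contraNneq nuv => ->; rewrite oppr0 mul0rn.
  congr (_, _); last by rewrite cu; ring.
  apply: (mulIf nz3); rewrite !mulr_natr tu; ring.
(* The roots sum to 0, so -(x + y) is again a root; it must be [x] or [y], and that one is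
   double. *)
have : (- (x + y)) ^+ 3 - (t * - (x + y)) *+ 3 == c.
  by rewrite -mulrnAl t3 cE; apply/eqP; ring.
rewrite rt => /orP[] /eqP z; [apply: (dblP x y) | apply: (dblP y x)] => //.
- by rewrite mulr2n -{1}z; ring.
- by rewrite mulr2n -{1}z; ring.
- by rewrite eq_sym.
- by rewrite t3; ring.
- by rewrite cE; ring.
Qed.

(** Summing [r_pointwise], with first moment q^2, second moment q(2q - 1) and at most q - 1
    double-root parameters, bounds three times the count by q^2 - 1. *)
Lemma card_noroot : (3 * (\sum_t \sum_c noroot t c) < #|F| ^ 2)%N.
Proof.
have q1 := finNzRing_gt1 F.
pose e t c := ((t, c) \in [set dbl x | x in [set~ 0%R]]).
have le : (\sum_t \sum_c (3 * noroot t c + 4 * r t c)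
    <= \sum_t \sum_c (r t c ^ 2 + 3 + e t c))%N.
  by do 2!apply: leq_sum => ? _; exact: r_pointwise.
have e_le : (\sum_t \sum_c e t c <= #|F|.-1)%N.
  rewrite pair_bigA /= -(cardsC1 (0 : F)).
  apply: leq_trans (leq_imset_card dbl _).
  rewrite -[X in (_ <= X)%N]sum1_card [X in (_ <= X)%N]big_mkcond leq_sum // =>
    -[t c] _.
  by rewrite /e; case: ifP.
move: le.
have -> : (\sum_t \sum_c (3 * noroot t c + 4 * r t c)
    = 3 * (\sum_t \sum_c noroot t c) + 4 * (\sum_t \sum_c r t c))%N.
  rewrite !big_distrr -big_split; apply: eq_bigr => t _.
  by rewrite !big_distrr -big_split.
have -> : (\sum_t \sum_c (r t c ^ 2 + 3 + e t c)
    = \sum_t \sum_c r t c ^ 2 + #|F| * (#|F| * 3) + \sum_t \sum_c e t c)%N.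
  rewrite -sum_nat_const -!big_split; apply: eq_bigr => t _.
  by rewrite -sum_nat_const -!big_split.
rewrite sum_r sum_r2; move: q1 e_le.
move: (\sum_t _)%N (\sum_t _)%N => X E; case: #|F| => // q _ /=.
rewrite -mulnn; nia.
Qed.

End DepressedCubics.

(** * Cubic characters and Jacobi sums *)

Definition cube (F : finFieldType) (x : F) : bool := [exists y, x == y ^+ 3].

Lemma noncube_neq0 (F : finFieldType) (a : F) : ~~ cube a -> a != 0.
Proof. by apply: contraNneq => ->; apply/existsP; exists 0; rewrite expr0n. Qed.

(** With the value 0 at 0, [rho] cubed is the trivial character extended by 0. Exponents are
    therefore taken in {1, 2, 3}, with 3 for the trivial character. The non-cube makes [rho]
    nontrivial. *)
Definition cubic_character (F : finFieldType) (rho : F -> algC) : Prop :=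
  [/\ {morph rho : x y / x * y}, rho 0 = 0,
      forall x : F, x != 0 -> rho x ^+ 3 = 1,
      forall x : F, x != 0 -> (rho x == 1) = cube x
    & exists g : F, ~~ cube g].

(** For a generator g of the unit group and a primitive cube root of unity w, set rho(g^i) = w^i;
    this is well defined because 3 divides q - 1. *)
Lemma cubic_character_exists (F : finFieldType) :
  #|F| = 1 %[mod 3] -> exists rho : F -> algC, cubic_character rho.
Proof.
move=> q1; have q_gt1 := finNzRing_gt1 F.
have n_gt0 : (0 < #|F|.-1)%N by rewrite -subn1 subn_gt0.
have d3 : (3 %| #|F|.-1)%N.
  by move/eqP: q1; rewrite -subn1 eqn_mod_dvd // ltnW.
have fermat (x : F) : x != 0 -> x ^+ #|F|.-1 = 1.
  move=> x0; apply: (mulfI x0); rewrite -exprS prednK ?(ltnW q_gt1) //.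
  by rewrite expf_card mulr1.
have /hasP[g _ prim_g] : has #|F|.-1.-primitive_root (enum [set~ (0 : F)]).
  apply: has_prim_root => //; last by rewrite -cardE cardsC1.
    apply/allP => x; rewrite mem_enum !inE => x0.
    by rewrite unity_rootE fermat.
  exact: enum_uniq.
have [w prim_w] := C_prim_root_exists (isT : (0 < 3)%N).
pose P (x : F) (i : 'I_#|F|.-1) := x == g ^+ i.
pose lg x := if [pick i | P x i] is Some i then i : nat else 0%N.
have lgE x : x != 0 -> x = g ^+ lg x.
  move=> x0; rewrite /lg; case: pickP => [i /eqP // | none].
  have [i xE] := prim_rootP prim_g (fermat x x0).
  by have := none i; rewrite /P xE eqxx.
have g0 : g != 0.
  by apply: contraTneq prim_g => ->; apply/negP => /prim_expr_order;
     rewrite expr0n gtn_eqF // => /esym/eqP; rewrite oner_eq0.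
have wE i j : g ^+ i = g ^+ j -> w ^+ i = w ^+ j.
  move/eqP; rewrite (eq_prim_root_expr prim_g) => ij.
  apply/eqP; rewrite (eq_prim_root_expr prim_w).
  by apply/eqP; move/eqP: ij => /(congr1 (modn^~ 3)); rewrite !modn_dvdm.
pose rho x := if x == 0 then 0 else w ^+ lg x.
have rhog i : rho (g ^+ i) = w ^+ i.
  by rewrite /rho expf_eq0 (negPf g0) andbF; apply: wE;
    rewrite -lgE // expf_neq0.
have rho0 : rho 0 = 0 by rewrite /rho eqxx.
have cubeP i : (rho (g ^+ i) == 1) = cube (g ^+ i).
  rewrite rhog -(prim_order_dvd prim_w); apply/idP/existsP.
    by move=> /dvdnP[j ->]; exists (g ^+ j); rewrite exprM.
  case=> y /eqP E; have y0 : y != 0.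
    by apply: contraNneq (expf_neq0 i g0) => y0; rewrite E y0 expr0n.
  move: E; rewrite (lgE y y0) -exprM => /wE E.
  by rewrite (prim_order_dvd prim_w) E mulnC exprM (prim_expr_order prim_w)
    expr1n.
exists rho; split=> //.
- move=> x y; have [->|x0] := eqVneq x 0; first by rewrite mul0r rho0 mul0r.
  have [->|y0] := eqVneq y 0; first by rewrite mulr0 rho0 mulr0.
  by rewrite (lgE x x0) (lgE y y0) -exprD !rhog exprD.
- move=> x x0; rewrite (lgE x x0) rhog exprAC.
  by rewrite (prim_expr_order prim_w) expr1n.
- by move=> x x0; rewrite (lgE x x0).
exists g; rewrite -[g]expr1 -cubeP rhog expr1.
by apply/negP => /eqP w1; have := prim_order_dvd prim_w 1;
  rewrite expr1 w1 eqxx.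
Qed.

Section CubicCharacter.

Variables (F : finFieldType) (rho : F -> algC).
Hypothesis rhoP : cubic_character rho.
Implicit Types x y z g h s t : F.

Local Notation q := (#|F|%:R : algC).

Lemma rhoM x y : rho (x * y) = rho x * rho y.
Proof. by case: rhoP => ->. Qed.

Lemma rho0 : rho 0 = 0.
Proof. by case: rhoP. Qed.

Lemma rhoX3 x : rho x ^+ 3 = (x != 0)%:R.
Proof.
have [->|x0] := eqVneq x 0; first by rewrite rho0 expr0n.
by case: rhoP => _ _ ->.
Qed.

Lemma rhoX4 x : rho x ^+ 4 = rho x.
Proof.
rewrite exprS rhoX3; have [->|x0] := eqVneq x 0; last by rewrite mulr1.
by rewrite rho0 mul0r.
Qed.

Lemma rho_eq1 x : x != 0 -> (rho x == 1) = cube x.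
Proof. by case: rhoP => _ _ _ H _; exact: H. Qed.

Lemma rho_cube x : x != 0 -> rho (x ^+ 3) = 1.
Proof.
move=> x0; apply/eqP; rewrite rho_eq1 ?expf_neq0 //.
by apply/existsP; exists x.
Qed.

Lemma rho1 : rho 1 = 1.
Proof. by rewrite -(expr1n _ 3) rho_cube ?oner_eq0. Qed.

Lemma rhoXn x n : rho (x ^+ n.+1) = rho x ^+ n.+1.
Proof. by elim: n => // n IHn; rewrite exprS rhoM IHn -exprS. Qed.

Lemma rhoN x : rho (- x) = rho x.
Proof.
have E : -1 = (-1) ^+ 3 :> F by rewrite -signr_odd expr1.
by rewrite -mulN1r rhoM E rho_cube ?mul1r // oppr_eq0 oner_eq0.
Qed.

Lemma rhoV x : rho x^-1 = rho x ^+ 2.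
Proof.
have [->|x0] := eqVneq x 0; first by rewrite invr0 rho0 expr0n.
have rx0 : rho x != 0.
  by apply/eqP => rx; have := rhoX3 x; rewrite rx x0 expr0n => /esym/eqP;
    rewrite oner_eq0.
apply: (mulfI rx0); rewrite -rhoM divff // rho1 -exprS rhoX3 x0 //.
Qed.

(** Orthogonality of the three characters of the units modulo cubes; writing the trivial one as
    [rho x ^+ 3] makes the formula hold at 0, which is a cube. *)
Lemma noncubeE x :
  (~~ cube x)%:R = (2%:R * rho x ^+ 3 - rho x - rho x ^+ 2) / 3%:R :> algC.
Proof.
have [->|x0] := eqVneq x 0.
  have -> : cube (0 : F) by apply/existsP; exists 0; rewrite expr0n.
  by rewrite rho0 !expr0n /= mulr0 !subr0 mul0r.
rewrite -rho_eq1 // rhoX3 x0; have [-> | r1] := eqVneq.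
  by rewrite expr1n /=; field.
have r3 : rho x ^+ 3 = 1 by rewrite rhoX3 x0.
have : (rho x - 1) * (rho x ^+ 2 + rho x + 1) = 0.
  by transitivity (rho x ^+ 3 - 1); [ring | rewrite r3 subrr].
move/eqP; rewrite mulf_eq0 subr_eq0 (negPf r1) /= => /eqP E.
have -> : rho x ^+ 2 = - rho x - 1 by rewrite -[RHS]add0r -E; ring.
by field.
Qed.

Definition noncube_coef (i : nat) : algC := if i == 3%N then 2%:R else -1.

Lemma noncube_sum x : (~~ cube x)%:R
  = (\sum_(i <- [:: 1; 2; 3]%N) noncube_coef i * rho x ^+ i) / 3%:R :> algC.
Proof.
rewrite noncubeE !big_cons big_nil /noncube_coef /=; congr (_ / _); ring.
Qed.

Lemma sum_rho : \sum_x rho x = 0.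
Proof.
case: (rhoP) => _ _ _ _ [g ng].
have g0 := noncube_neq0 ng.
have E : \sum_x rho x = rho g * \sum_x rho x.
  rewrite [LHS](reindex_inj (mulfI g0)) big_distrr.
  by apply: eq_bigr => x _; exact: rhoM.
move/eqP: E; rewrite -subr_eq0 -{1}[\sum_x _]mul1r -mulrBl mulf_eq0 subr_eq0.
by rewrite eq_sym rho_eq1 // (negPf ng) => /eqP.
Qed.

Lemma sum_rho2 : \sum_x rho x ^+ 2 = 0.
Proof.
rewrite -[RHS]sum_rho [RHS](reindex_inj invr_inj).
by apply: eq_bigr => x _; rewrite rhoV.
Qed.

Lemma sum_rho3 : \sum_x rho x ^+ 3 = q - 1.
Proof.
under eq_bigr => x _ do rewrite rhoX3.
rewrite -natr_sum -(natrB _ (ltnW (finNzRing_gt1 F))) subn1 -(cardC1 0).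
by rewrite -sum1_card [in RHS]big_mkcond; congr _%:R; apply: eq_bigr => x _.
Qed.

Lemma sum_noncube : 3%:R * \sum_(x : F) (~~ cube x)%:R = 2%:R * (q - 1) :> algC.
Proof.
under eq_bigr => x _ do rewrite noncubeE.
rewrite -big_distrl /= !sumrB -big_distrr /= sum_rho sum_rho2 sum_rho3.
by field.
Qed.

(** Every nonzero cube has as many cube roots as 1, say [k]. Counting the nonzero t according to
    their cubes gives q - 1 = (k / 3)(q - 1), hence k = 3. *)
Lemma sum_cube_roots x :
  \sum_t ((t != 0) && (t ^+ 3 == x))%:R = rho x ^+ 3 + rho x + rho x ^+ 2.
Proof.
pose k : algC := \sum_(t : F) ((t != 0) && (t ^+ 3 == 1))%:R.
have main y : y != 0 ->
    \sum_t ((t != 0) && (t ^+ 3 == y))%:R = k / 3%:R * (rho y ^+ 3 + rho y +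
      rho y ^+ 2).
  move=> y0; have := noncubeE y; have := rhoX3 y; rewrite y0.
  have [/existsP[z /eqP yE]|ncy] := boolP (cube y).
    have z0 : z != 0 by apply: contraNneq y0 => z0; rewrite yE z0 expr0n.
    have -> : rho y = 1 by rewrite yE rho_cube.
    rewrite !expr1n => _ _; transitivity k; last by field.
    rewrite [LHS](reindex_inj (mulfI z0)); apply: eq_bigr => t _.
    rewrite mulf_eq0 (negPf z0) exprMn -yE.
    by rewrite -{2}[y]mulr1 (inj_eq (mulfI y0)).
  move=> -> /= E.
  have -> : 1 + rho y + rho y ^+ 2
      = 3%:R * (1 - (2%:R * 1 - rho y - rho y ^+ 2) / 3%:R) by field.
  rewrite -E subrr mulr0.
  rewrite mulr0 big1 // => t _; case: (t ^+ 3 =P y) => [E'|];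
    last by rewrite andbF.
  by case/negP: ncy; apply/existsP; exists t; rewrite E'.
have k3 : k = 3%:R.
  have : \sum_(y : F) \sum_(t : F) ((t != 0) && (t ^+ 3 == y))%:R
      = \sum_y k / 3%:R * (rho y ^+ 3 + rho y + rho y ^+ 2).
    apply: eq_bigr => y _; have [->|] := eqVneq y 0; last exact: main.
    rewrite rho0 !expr0n /= !addr0 mulr0 big1 // => t _.
    by rewrite expf_eq0 /=; case: eqP.
  rewrite -big_distrr /= !big_split /= sum_rho sum_rho2 !addr0.
  rewrite exchange_big /= (eq_bigr (fun t => rho t ^+ 3)); last first.
    move=> t _; rewrite rhoX3 (bigD1 (t ^+ 3)) //= eqxx andbT big1 ?addr0 // =>
      y.
    by rewrite eq_sym => /negPf->; rewrite andbF.
  have q1 : q - 1 != 0 by rewrite subr_eq0 (eqr_nat _ _ 1) gtn_eqF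
    ?finNzRing_gt1.
  rewrite sum_rho3 -{1}[q - 1]mul1r => /(mulIf q1) E.
  by rewrite -[k](divfK (_ : 3%:R != 0)) -?E ?mul1r ?pnatr_eq0.
have [->|x0] := eqVneq x 0; last by rewrite main // k3; field.
rewrite rho0 !expr0n /= !addr0 big1 // => t _.
by rewrite expf_eq0 /=; case: eqP.
Qed.

(** The Jacobi sum of two powers of the character; using x - 1 instead of the customary 1 - x
    changes nothing, since rho(-1) = 1. *)
Definition jacobi (i j : nat) : algC := \sum_x rho x ^+ i * rho (x - 1) ^+ j.

(** Exponents reduce modulo 3 only down to 1: exponents 0 and 3 differ at the argument 0. *)
Lemma rhoXS x n : rho x ^+ n.+4 = rho x ^+ n.+1.
Proof. by rewrite -addn4 exprD rhoX4 -exprSr. Qed.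

Lemma jacobiSl i j : jacobi i.+4 j = jacobi i.+1 j.
Proof. by apply: eq_bigr => x _; rewrite rhoXS. Qed.

Lemma jacobiSr i j : jacobi i j.+4 = jacobi i j.+1.
Proof. by apply: eq_bigr => x _; rewrite rhoXS. Qed.

Lemma jacobi_twist h i j : h != 0 ->
  \sum_x rho x ^+ i * rho (x - h) ^+ j = rho h ^+ (i + j) * jacobi i j.
Proof.
move=> h0; rewrite (reindex_inj (mulfI h0)) big_distrr;
  apply: eq_bigr => x _ /=.
have -> : h * x - h = h * (x - 1) by ring.
by rewrite !rhoM !exprMn exprD; ring.
Qed.

(* Substitute v = 1/z to make the sum that of rho over an affine line. *)
Lemma sum_rho_affine s t :
  \sum_z rho (t * z + s) * rho z ^+ 2 = (q * (s == 0)%:R - 1) * rho t.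
Proof.
transitivity (\sum_(z | z != 0) rho (t + s * z)).
  rewrite (reindex_inj invr_inj) [RHS]big_mkcond; apply: eq_bigr => z _ /=.
  have [->|z0] := eqVneq z 0; first by rewrite invr0 rho0 expr0n mulr0.
  rewrite -rhoV invrK -rhoM; congr rho.
  by rewrite mulrDl divfK.
have -> : \sum_(z | z != 0) rho (t + s * z) = \sum_z rho (t + s * z) - rho t.
  by rewrite [X in _ = X - _](bigD1 0) //= mulr0 addr0 [RHS]addrC addKr.
have [->|s0] := eqVneq s 0.
  under eq_bigr => z _ do rewrite mul0r addr0.
  by rewrite sumr_const -[_ *+ #|_|]mulr_natr /=; ring.
rewrite (reindex_inj (mulfI (invr_neq0 s0))) /=.
under eq_bigr => z _ do rewrite mulVKf // addrC.
have /= <- := reindex_inj (addIr t) (op := +%R) (P := predT) (F := rho).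
by rewrite sum_rho; ring.
Qed.

Lemma sum_rhoX (i : nat) : (0 < i < 3)%N -> \sum_x rho x ^+ i = 0.
Proof.
by case: i => [|[|[|]]] // _; [exact: sum_rho | exact: sum_rho2].
Qed.

(** The trivial character only deletes the term x = 1, equal to 1, from a vanishing sum. *)
Lemma jacobi_r3 i : (0 < i < 3)%N -> jacobi i 3 = -1.
Proof.
move=> /sum_rhoX; rewrite /jacobi (bigD1 1) //= rho1 expr1n => /eqP.
rewrite addrC addr_eq0 => /eqP <-;
  rewrite [LHS](bigD1 1) //= rhoX3 subrr eqxx mulr0 add0r.
by apply: eq_bigr => x x1; rewrite rhoX3 subr_eq0 x1 mulr1.
Qed.

Lemma jacobi_3r i : (0 < i < 3)%N -> jacobi 3 i = -1.
Proof.
move=> i_range; rewrite -(jacobi_r3 i_range) /jacobi (reindex_inj (inv_inj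
  (subKr 1))).
apply: eq_bigr => x _; rewrite /= mulrC; congr (_ ^+ _ * _ ^+ _).
  by rewrite -rhoN; congr rho; ring.
by rewrite -rhoN; congr rho; ring.
Qed.

Lemma jacobi33 : jacobi 3 3 = q - 2%:R.
Proof.
have -> : q - 2%:R = \sum_x rho x ^+ 3 - 1 by rewrite sum_rho3; ring.
rewrite /jacobi (bigD1 1) //= subrr rho0 expr0n mulr0 add0r.
rewrite [X in _ = X - _](bigD1 1) //= rho1 expr1n [RHS]addrC addKr.
by apply: eq_bigr => x x1; rewrite (rhoX3 (x - 1)) subr_eq0 x1 mulr1.
Qed.

Lemma jacobi12 : jacobi 1 2 = -1.
Proof.
transitivity (\sum_z rho (1 * z + 1) * rho z ^+ 2).
  rewrite /jacobi (reindex_inj (addIr 1)); apply: eq_bigr => z _ /=.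
  by rewrite mul1r addrK.
by rewrite sum_rho_affine oner_eq0 rho1 mulr0 sub0r mulr1.
Qed.

Lemma jacobi21 : jacobi 2 1 = -1.
Proof.
transitivity (\sum_z rho (1 * z + -1) * rho z ^+ 2).
  by apply: eq_bigr => z _ /=; rewrite mul1r mulrC.
by rewrite sum_rho_affine oppr_eq0 oner_eq0 rho1 mulr0 sub0r mulr1.
Qed.

(** In the double sum put x = t y: the powers of rho(y) combine into its cube, and for fixed t the
    sum over y is an affine one, completed by the term y = 0, which equals 1. By [sum_rho_affine]
    only t = 1 contributes a multiple of q. *)
Lemma jacobi_norm : jacobi 1 1 * jacobi 2 2 = q.
Proof.
transitivity (\sum_t rho t * (\sum_y rho (t * y + -1) * rho (y - 1) ^+ 2 - 1)).
  rewrite /jacobi mulrC big_distrlr /=.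
  transitivity (\sum_(y | y != 0) \sum_t rho t * (rho (t * y + -1) * rho (y -
    1) ^+ 2)).
    rewrite [LHS](bigD1 0) //= big1 ?add0r => [|x _];
      last by rewrite rho0 !expr0n !mul0r.
    apply: eq_bigr => y y0; rewrite (reindex_inj (mulIf y0));
      apply: eq_bigr => t _ /=.
    rewrite rhoM; transitivity (rho y ^+ 3 * (rho t * (rho (t * y + -1) * rho
      (y - 1) ^+ 2))).
      by ring.
    by rewrite rhoX3 y0 mul1r.
  rewrite exchange_big; apply: eq_bigr => t _ /=; rewrite -big_distrr;
    congr (_ * _).
  rewrite [in RHS](bigD1 0) //= mulr0 !add0r rhoN rho1 mul1r expr1n; ring.
transitivity (\sum_t (rho t * (- rho t - 1) + (1 == t)%:R * q)).
  apply: eq_bigr => t _.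
  have -> : \sum_y rho (t * y + -1) * rho (y - 1) ^+ 2 = \sum_z rho (t * z + (t
    - 1)) * rho z ^+ 2.
    rewrite (reindex_inj (addIr 1)); apply: eq_bigr => z _ /=.
    by rewrite addrK; congr (rho _ * _); ring.
  rewrite sum_rho_affine subr_eq0 [1 == t]eq_sym;
    case: (eqVneq t 1) => [->|_] /=.
    by rewrite rho1; ring.
  by ring.
rewrite big_split /= sum_delta.
rewrite (eq_bigr (fun t => - rho t ^+ 2 - rho t)) => [|t _]; last by ring.
by rewrite sumrB sumrN sum_rho2 sum_rho; ring.
Qed.

End CubicCharacter.

(** * Points of the cubic twists *)

Section CurvePoints.

Variable F : finFieldType.
Implicit Types (h x y z : F) (v : 'rV[F]_3).

Let vec x y z : 'rV[F]_3 := \row_i nth 0 [:: x; y; z] i.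

Let vecE v : v = vec (v 0 0) (v 0 1) (v 0 2).
Proof.
apply/rowP => i; rewrite mxE; case: i => -[|[|[|//]]] i_lt /=;
  by congr (v _ _); apply: val_inj.
Qed.

Let vec0 x y z : vec x y z 0 0 = x. Proof. by rewrite mxE. Qed.
Let vec1 x y z : vec x y z 0 1 = y. Proof. by rewrite mxE. Qed.
Let vec2 x y z : vec x y z 0 2 = z. Proof. by rewrite mxE. Qed.

Let scale_vec (a : F) x y z : a *: vec x y z = vec (a * x) (a * y) (a * z).
Proof. by rewrite [LHS]vecE !mxE. Qed.

Let proj_point_refl v : v \in proj_point v.
Proof. by apply/imsetP; exists 1; rewrite ?inE ?oner_eq0 // scale1r. Qed.

Let proj_point_scale (a : F) v : a != 0 -> proj_point (a *: v) = proj_point v.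
Proof.
move=> a0; apply/setP => u; apply/imsetP/imsetP => -[b]; rewrite !inE => b0 ->.
  by exists (b * a); rewrite ?inE ?mulf_neq0 // scalerA.
by exists (b / a); rewrite ?inE ?mulf_neq0 ?invr_eq0 // scalerA divfK.
Qed.

(** At z = 0 the equation forces x = 0, so (0 : 1 : 0) is the only point at infinity; every other
    point is normalised to z = 1. *)
Lemma card_cubic_twist h : h != 0 ->
  #|cubic_twist h| = (1 + \sum_y \sum_x (h * x ^+ 3 == y * (y - 1))%R)%N.
Proof.
move=> h0.
pose A := [set u : F * F | h * u.1 ^+ 3 == u.2 * (u.2 - 1)].
pose f (u : F * F) := proj_point (vec u.1 u.2 1).
have f_inj : injective f.
  move=> [x y] [x' y'] E; have := proj_point_refl (vec x y 1).
  rewrite [proj_point _]E => /imsetP[a _ /=]; rewrite scale_vec => E'.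
  have a1 : a = 1 by move/(congr1 (fun v : 'rV_3 => v 0 2)): E';
    rewrite !vec2 mulr1.
  move: E'; rewrite a1 !mul1r => E'.
  move/(congr1 (fun v : 'rV_3 => v 0 0)): (E'); rewrite !vec0 => ->.
  by move/(congr1 (fun v : 'rV_3 => v 0 1)): (E'); rewrite !vec1 => ->.
have -> : cubic_twist h = proj_point (vec 0 1 0) |: f @: A.
  apply/setP => P; rewrite in_setU1; apply/imsetP/orP.
    case=> v; rewrite inE => /andP[v0 /eqP vh] ->.
    rewrite [v]vecE in v0 vh *.
    move: (v 0 0) (v 0 1) (v 0 2) v0 vh => x y z;
      rewrite vec0 vec1 vec2 => v0 vh.
    have [z0|z0] := eqVneq z 0; [left | right].
      rewrite z0 mulr0 in v0 vh *; have x0 : x = 0.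
        by apply/eqP; move/eqP: vh; rewrite mulf_eq0 (negPf h0) expf_eq0.
      rewrite x0 in v0 *; have y0 : y != 0.
        apply: contraNneq v0 => ->; apply/eqP/rowP => i; rewrite !mxE.
        by case: i => -[|[|[|//]]] i_lt.
      by rewrite -(proj_point_scale (vec 0 1 0) y0) scale_vec mulr0 mulr1.
    apply/imsetP; exists (x / z, y / z).
      rewrite inE /=; apply/eqP/(mulfI (expf_neq0 3 z0)).
      transitivity (h * x ^+ 3); first by field.
      by rewrite vh; field.
    rewrite /f /= -(proj_point_scale (vec x y z) (invr_neq0 z0)) scale_vec.
    by rewrite mulVf // ![z^-1 * _]mulrC.
  case=> [/eqP -> | /imsetP[[x y]]].
    exists (vec 0 1 0) => //;
      rewrite inE vec0 vec1 vec2 /= expr0n !mulr0 eqxx andbT.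
    apply/negP => /eqP/(congr1 (fun v : 'rV_3 => v 0 1)).
    by rewrite vec1 mxE => /eqP; rewrite oner_eq0.
  rewrite inE /= => /eqP xy ->; exists (vec x y 1) => //.
  rewrite inE vec0 vec1 vec2 /= xy mulr1 eqxx andbT.
  apply/negP => /eqP/(congr1 (fun v : 'rV_3 => v 0 2)).
  by rewrite vec2 mxE => /eqP; rewrite oner_eq0.
rewrite cardsU1 card_imset //.
have -> : proj_point (vec 0 1 0) \notin f @: A.
  apply/negP => /imsetP[[x y] _] E; have := proj_point_refl (vec x y 1).
  rewrite -[proj_point _]E => /imsetP[a _ /=]; rewrite scale_vec mulr0.
  move/(congr1 (fun v : 'rV_3 => v 0 2)); rewrite !vec2 => /eqP.
  by rewrite oner_eq0.
rewrite -sum1_card exchange_big pair_bigA big_mkcond; congr addn.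
by apply: eq_bigr => u _; rewrite inE; case: ifP.
Qed.

End CurvePoints.

(** For fixed y, the number of x is 1 + rho(z) + rho(z)^2 with z = y(y - 1) / h; summing over y
    produces the two Jacobi sums, and the division by [h] turns rho(h) into its square. *)
Lemma cubic_twist_jacobi (F : finFieldType) (rho : F -> algC) (h : F) :
  cubic_character rho -> h != 0 ->
  1 + #|F|%:R - #|cubic_twist h|%:R
    = - (rho h ^+ 2 * jacobi rho 1 1 + rho h * jacobi rho 2 2) :> algC.
Proof.
move=> rhoP h0; rewrite card_cubic_twist // natrD natr_sum.
have E (y : F) : (\sum_x (h * x ^+ 3 == y * (y - 1))%R)%N%:R
    = 1 + rho h ^+ 2 * (rho y ^+ 1 * rho (y - 1) ^+ 1)
        + rho h * (rho y ^+ 2 * rho (y - 1) ^+ 2) :> algC.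
  pose z := y * (y - 1) / h.
  transitivity (1 + rho z + rho z ^+ 2); last first.
    rewrite /z !(rhoM rhoP) (rhoV rhoP).
    by rewrite -[X in _ = _ + X * _](rhoX4 rhoP h); ring.
  (* [sum_cube_roots] ignores the root 0, so x = 0 is split off; it is a solution exactly when z =
     0. *)
  transitivity ((z == 0)%:R + \sum_t ((t != 0) && (t ^+ 3 == z))%:R : algC).
    rewrite natr_sum (bigD1 0) //= [in RHS](bigD1 0) //= eqxx add0r.
    congr (_ + _).
      by rewrite /z expr0n mulr0 mulf_eq0 invr_eq0 (negPf h0) orbF eq_sym.
    apply: eq_bigr => x ->; rewrite /z /=; congr (nat_of_bool _)%:R.
    by rewrite mulrC (can2_eq (mulfK h0) (divfK h0)).
  rewrite (sum_cube_roots rhoP) (rhoX3 rhoP).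
  by case: (z == 0) => /=; ring.
under eq_bigr => y _ do rewrite E.
rewrite !big_split /= -!big_distrr /= sumr_const -/(jacobi rho 1 1) -/(jacobi
  rho 2 2).
by ring.
Qed.

(** * Cubes and resolvents: q = 1 mod 3 *)

(* Cardano backwards: a cube root g of a with g^2 - x g + t = 0 is rational,
   because g^3 = (x^2 - t) g - x t. *)
Lemma resolvent_root_cube (F : finFieldType) (a t x : F) :
  a ^+ 2 - (x ^+ 3 - (t * x) *+ 3) * a + t ^+ 3 = 0 -> cube a.
Proof.
move=> E; apply/existsP; have [x2t|] := eqVneq (x ^+ 2) t.
  (* Here the resolvent is (Z + x^3)^2, so a = (-x)^3. *)
  exists (- x); rewrite -subr_eq0 -[_ == 0](expf_eq0 _ 2) -E -x2t.
  by apply/eqP; ring.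
rewrite -subr_eq0 => nz; exists ((a + x * t) / (x ^+ 2 - t)).
rewrite expr_div_n -(can2_eq (mulfK (expf_neq0 3 nz)) (divfK (expf_neq0 3 nz))).
rewrite eq_sym -subr_eq0 -(mulr0 (a + x ^+ 3)) -E; apply/eqP; ring.
Qed.

Lemma sum_squeeze (T : finType) (u v : T -> nat) :
  (forall i, u i <= v i)%N -> (\sum_i v i <= \sum_i u i)%N -> u =1 v.
Proof.
move=> le_uv le_sum i.
have := leqif_sum (fun i _ => leqif_eq (le_uv i)) (P := predT).
by move/geq_leqif; rewrite le_sum => /esym/forallP/(_ i)/eqP.
Qed.

Lemma card_quadratic_roots (F : finFieldType) (b c : F) :
  (#|[set a : F | (a ^+ 2 - b * a + c == 0)%R]| <= 2)%N.
Proof.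
have [->|[a]] := set_0Vmem [set a : F | a ^+ 2 - b * a + c == 0];
  first by rewrite cards0.
rewrite inE => /eqP Ea; apply: (@leq_trans #|[set a; b - a]|).
  apply/subset_leq_card/subsetP => x; rewrite !inE => /eqP Ex.
  rewrite -[x == a]subr_eq0 -[x == b - a]subr_eq0 -mulf_eq0.
  by rewrite -(subrr 0) -{1}Ex -Ea; apply/eqP; ring.
by rewrite cards2; case: eqP.
Qed.

(** By [card_noroot] the total of [w] is already as large as the pointwise bounds allow, so every
    bound is an equality. Thus bounding certificates and counting them suffices to know that each
    rootless cubic has one. *)
Lemma noroot_weight (F : finFieldType) (w : F -> F -> nat) :
  3%:R != 0 :> F -> (forall t c, w t c <= 2 * noroot t c)%N ->
  (3 * (\sum_t \sum_c w t c) = 2 * (#|F| ^ 2).-1)%N ->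
  forall t c, w t c = (2 * noroot t c)%N.
Proof.
move=> nz3 w_le w_sum t c.
pose u (p : F * F) := w p.1 p.2; pose v (p : F * F) := (2 * noroot p.1 p.2)%N.
apply: (sum_squeeze (u := u) (v := v) _ _ (t, c)) => [p|]; first exact: w_le.
rewrite -(pair_bigA _ w) -(pair_bigA _ (fun t c => 2 * noroot t c)%N) /=.
rewrite -(leq_pmul2l (isT : (0 < 3)%N)) w_sum; have := card_noroot nz3.
have -> : (\sum_(t : F) \sum_(c : F) 2 * noroot t c
           = 2 * \sum_(t : F) \sum_(c : F) noroot t c)%N.
  rewrite [RHS]big_distrr; apply: eq_bigr => s _.
  by rewrite [RHS]big_distrr.
by move: (\sum_t _)%N (#|F| ^ 2)%N => S Q; lia.
Qed.

Section SplitResolvent.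

Variables (F : finFieldType) (rho : F -> algC).
Hypotheses (rhoP : cubic_character rho) (nz3 : 3%:R != 0 :> F).
Implicit Types a b c d h t x y : F.

Local Notation q := (#|F|%:R : algC).

Let res a t c : bool := ~~ cube a && (a ^+ 2 - c * a + t ^+ 3 == 0).

(* For t = 0 one of the two roots of the resolvent is 0, hence the weight. *)
Let w t c : nat := ((1 + (t == 0%R)) * \sum_a res a t c)%N.

Let resE a t c : res a t c = ~~ cube a && (a + t ^+ 3 / a == c).
Proof.
rewrite /res; case: (boolP (cube a)) => //= /noncube_neq0 a0.
rewrite -[RHS](inj_eq (mulIf a0)) -[RHS]subr_eq0; congr (_ == 0).
by rewrite mulrDl divfK //; ring.
Qed.

(** If the cubic has a root, [resolvent_root_cube] leaves no certificate. Otherwise a quadratic has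
    at most two roots, and for t = 0 the only nonzero candidate is a = c. *)
Let w_le t c : (w t c <= 2 * noroot t c)%N.
Proof.
rewrite /w; case: (boolP (noroot t c)) => [_|]; last first.
  rewrite negb_forall => /existsP[x]; rewrite negbK => /eqP xc.
  rewrite big1 ?muln0 // => a _; apply/eqP; rewrite eqb0;
    apply/negP => /andP[nc /eqP E].
  by case/negP: nc; apply: (@resolvent_root_cube _ a t x); rewrite xc.
have -> : (\sum_a res a t c = #|[set a | res a t c]|)%N.
  by rewrite -sum1_card [RHS]big_mkcond; apply: eq_bigr => a _; rewrite inE;
    case: ifP.
have [t0|t0] := eqVneq t 0.
  rewrite leq_pmul2l // -[nat_of_bool true](cards1 c);
    apply/subset_leq_card/subsetP => a.
  by rewrite !inE resE t0 expr0n mul0r addr0 => /andP[_].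
rewrite mul1n muln1; apply: leq_trans (card_quadratic_roots c (t ^+ 3)).
by apply/subset_leq_card/subsetP => a; rewrite !inE => /andP[].
Qed.

Let noncubes : (3 * (\sum_(a : F) ~~ cube a) = 2 * #|F|.-1)%N.
Proof.
apply/eqP; rewrite -(eqr_nat algC) !natrM natr_sum (sum_noncube rhoP).
by rewrite -subn1 natrB // ltnW // finNzRing_gt1.
Qed.

(** Given t, each non-cube [a] is a root of the resolvent for exactly one c, and t = 0 counts twice:
    the total is (q + 1) times the number of non-cubes. *)
Let w_sum : (3 * (\sum_t \sum_c w t c) = 2 * (#|F| ^ 2).-1)%N.
Proof.
have q1 := finNzRing_gt1 F.
have -> : (\sum_t \sum_c w t c = \sum_(t : F) (1 + (t == 0%R)) * \sum_(a : F)
  ~~ cube a)%N.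
  apply: eq_bigr => t _; rewrite -big_distrr; congr muln.
  rewrite exchange_big; apply: eq_bigr => a _ /=.
  under eq_bigr => c _ do rewrite resE -mulnb.
  by rewrite -big_distrr /= sum_deltan muln1.
rewrite -big_distrl big_split /= sum1_card.
under eq_bigr => t _ do rewrite eq_sym.
rewrite sum_deltan mulnCA noncubes -mulnn; case: #|F| q1 => // n _.
by rewrite /=; lia.
Qed.

Let w_noroot : forall t c, w t c = (2 * noroot t c)%N.
Proof. exact: noroot_weight. Qed.

Section Count.

Variable h : F.
Hypothesis h0 : h != 0.

Let nc a : algC := (~~ cube a)%:R.
Let T t : algC :=
  \sum_a \sum_b nc a * nc b * (b + t ^+ 3 / b == a + t ^+ 3 / a + h)%:R.

(** Each rootless cubic has weight 2, so a pair has weight 4; for t = 0 this 4 is the square of the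
    extra factor of [w]. *)
Let pairs_T : 4%:R * (noroot_pairs h)%:R = 4%:R * T 0 + \sum_(t | t != 0) T t.
Proof.
transitivity (\sum_t (1 + (t == 0)%:R) ^+ 2 * T t); last first.
  rewrite (bigD1 0) //= eqxx; congr (_ + _); first by rewrite /=; ring.
  by apply: eq_bigr => t /negPf ->; rewrite addr0 expr1n mul1r.
transitivity ((\sum_t \sum_c w t c * w t (c + h)%R)%N%:R : algC).
  rewrite -natrM /noroot_pairs big_distrr; congr _%:R; apply: eq_bigr => t _.
  rewrite big_distrr; apply: eq_bigr => c _; rewrite !w_noroot.
  by do 2!case: noroot.
rewrite natr_sum; apply: eq_bigr => t _; rewrite natr_sum.
transitivity (\sum_c (1 + (t == 0)%:R) ^+ 2 *
    \sum_a \sum_b (nc a * nc b) * ((a + t ^+ 3 / a == c)%:R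
      * (b + t ^+ 3 / b == c + h)%:R)).
  apply: eq_bigr => c _; rewrite natrM /w !natrM natrD !natr_sum.
  transitivity ((1 + (t == 0)%:R) ^+ 2 *
    ((\sum_a (res a t c)%:R) * (\sum_b (res b t (c + h))%:R)) : algC);
      first by ring.
  rewrite big_distrlr; congr (_ * _); apply: eq_bigr => a _;
    apply: eq_bigr => b _.
  by rewrite /= !resE -!mulnb !natrM /nc; ring.
rewrite -big_distrr; congr (_ * _); rewrite exchange_big; apply: eq_bigr => a _.
rewrite exchange_big; apply: eq_bigr => b _.
by rewrite -big_distrr /= sum_delta.
Qed.

Let T0 : T 0 = \sum_a nc (a - h) * nc a.
Proof.
rewrite /T exchange_big; apply: eq_bigr => b _.
rewrite (bigD1 (b - h)) //= big1 ?addr0 => [|a ab].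
  by rewrite expr0n !mul0r !addr0 subrK eqxx mulr1.
rewrite expr0n !mul0r !addr0 -subr_eq [_ == a]eq_sym (negPf ab) mulr0 //.
Qed.

Let G x : algC := rho x ^+ 3 + rho x + rho x ^+ 2.

(** The condition on t reads t^3 = ab(b - a - h) / (b - a), and [G] counts its nonzero solutions.
    With d = b - a and then b = d y, the right side becomes d(d - h) y(y - 1), which separates d
    from y. *)
Let sumT : \sum_(t | t != 0) T t
  = \sum_d \sum_b nc (d * b) * nc (d * (b - 1)) * G (d * (d - h) * b * (b - 1)).
Proof.
have GE x : G x = \sum_t ((t != 0) && (t ^+ 3 == x))%:R by rewrite
  (sum_cube_roots rhoP).
transitivity (\sum_a \sum_b nc a * nc b * G (a * b * (b - a - h) / (b - a))).
  rewrite exchange_big; apply: eq_bigr => a _; rewrite exchange_big;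
    apply: eq_bigr => b _ /=.
  rewrite -big_distrr /= GE big_mkcond /nc.
  case: (boolP (cube a)) => [_|/noncube_neq0 a0]; first by rewrite !mul0r.
  case: (boolP (cube b)) => [_|/noncube_neq0 b0]; first by rewrite mulr0 !mul0r.
  congr (_ * _); apply: eq_bigr => t _; case: eqVneq => //= t0;
    congr (nat_of_bool _)%:R.
  (* If a = b the original condition would say h = 0, while division by 0 gives 0 on the other side,
     excluded by t != 0: both are false. *)
  have [ab|] := eqVneq (b - a) 0.
    rewrite ab invr0 mulr0 expf_eq0 (negPf t0) andbF.
    move/eqP: ab; rewrite subr_eq0 => /eqP ->.
    by rewrite -[X in X == _]addr0 (inj_eq (addrI _)) eq_sym (negPf h0).
  move=> ba0; rewrite -(inj_eq (mulIf (mulf_neq0 a0 b0))).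
  rewrite -[RHS](can2_eq (mulfK ba0) (divfK ba0)) -subr_eq0 -[RHS]subr_eq0
    -[RHS]oppr_eq0.
  congr (_ == 0); rewrite !mulrDl.
  have -> : t ^+ 3 / b * (a * b) = t ^+ 3 * a by field.
  have -> : t ^+ 3 / a * (a * b) = t ^+ 3 * b by field.
  by ring.
rewrite exchange_big.
transitivity (\sum_b \sum_d nc (b - d) * nc b * G ((b - d) * b * (d - h) / d)).
  apply: eq_bigr => b _; rewrite (reindex_inj (inv_inj (subKr b)));
    apply: eq_bigr => d _ /=.
  by rewrite subKr.
rewrite exchange_big; apply: eq_bigr => d _; have [->|d0] := eqVneq d 0.
  rewrite !big1 // => b _;
    rewrite /G ?invr0 ?mulr0 ?mul0r (rho0 rhoP) // !expr0n /=; ring.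
rewrite (reindex_inj (mulfI d0)); apply: eq_bigr => b _ /=.
rewrite [nc _ * _]mulrC; congr (_ * nc _ * G _); first by ring.
by field.
Qed.

Local Notation m := noncube_coef.
Let s3 : seq nat := [:: 1; 2; 3]%N.

Let ncE a : nc a = (\sum_(i <- s3) m i * rho a ^+ i) / 3%:R.
Proof. exact: noncube_sum. Qed.

Let GE a : G a = \sum_(i <- s3) rho a ^+ i.
Proof. by rewrite /G /s3 !big_cons big_nil; ring. Qed.

Local Notation J := (jacobi rho).
Local Notation X := (rho h).

Let T0_jacobi : 9%:R * T 0 = \sum_(i <- s3) \sum_(j <- s3) m i * m j * (X ^+ (i
  + j) * J i j).
Proof.
rewrite T0 big_distrr.
transitivity (\sum_a \sum_(i <- s3) \sum_(j <- s3) m i * m j * (rho a ^+ i *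
  rho (a - h) ^+ j)).
  apply: eq_bigr => a _; rewrite /= !ncE.
  transitivity ((\sum_(i <- s3) m i * rho a ^+ i) * (\sum_(i <- s3) m i * rho
    (a - h) ^+ i)).
    by field.
  rewrite big_distrlr; apply: eq_bigr => i _; apply: eq_bigr => j _ /=; ring.
rewrite exchange_big; apply: eq_bigr => i _; rewrite exchange_big;
  apply: eq_bigr => j _ /=.
by rewrite -big_distrr /= (jacobi_twist rhoP).
Qed.

(** Expand the two non-cube indicators with exponents [i], [j] and [G] with [k]. Then d, d - h, b
    and b - 1 carry the exponents i + j + k, k, i + k and j + k, so the double sum is a product of
    two Jacobi sums. *)
Let sumT_jacobi : 9%:R * (\sum_(t | t != 0) T t)
  = \sum_(i <- s3) \sum_(j <- s3) \sum_(k <- s3)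
      m i * m j * (X ^+ (i + j + k + k) * J (i + j + k) k * J (i + k) (j + k)).
Proof.
rewrite sumT big_distrr.
transitivity (\sum_d \sum_b \sum_(i <- s3) \sum_(j <- s3) \sum_(k <- s3) m i *
  m j *
   ((rho d ^+ (i + j + k) * rho (d - h) ^+ k) * (rho b ^+ (i + k) * rho (b - 1)
     ^+ (j + k)))).
  apply: eq_bigr => d _; rewrite big_distrr; apply: eq_bigr => b _;
    rewrite /= !ncE GE.
  set A := \sum_(i <- s3) _; set B := \sum_(i <- s3) _;
    set E := \sum_(i <- s3) _.
  transitivity (A * B * E); first by rewrite /=; field.
  rewrite big_distrlr big_distrl; apply: eq_bigr => i _.
  rewrite big_distrl; apply: eq_bigr => j _; rewrite big_distrr;
    apply: eq_bigr => k _ /=.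
  rewrite !(rhoM rhoP) !exprMn !exprD; ring.
transitivity (\sum_(i <- s3) \sum_(j <- s3) \sum_(k <- s3) m i * m j *
   ((\sum_d rho d ^+ (i + j + k) * rho (d - h) ^+ k) * J (i + k) (j + k))).
  under eq_bigr => d _ do rewrite exchange_big.
  rewrite exchange_big; apply: eq_bigr => i _.
  under eq_bigr => d _ do rewrite exchange_big.
  rewrite exchange_big; apply: eq_bigr => j _.
  under eq_bigr => d _ do rewrite exchange_big.
  rewrite exchange_big; apply: eq_bigr => k _.
  rewrite /jacobi big_distrlr big_distrr; apply: eq_bigr => d _.
  by rewrite big_distrr.
do 3!apply: eq_bigr => ? _.
by rewrite (jacobi_twist rhoP).
Qed.

(** Once the exponents are reduced to {1, 2, 3}, every Jacobi sum is explicit except [J 1 1] and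
    [J 2 2]. *)
Lemma noroot_pairs_jacobi : 9%:R * (noroot_pairs h)%:R
  = q ^+ 2 - q - 6%:R + 2%:R * (X + X ^+ 2)
    + X ^+ 2 * J 1 1 ^+ 2 + X * J 2 2 ^+ 2 :> algC.
Proof.
have nz4 : 4%:R != 0 :> algC by rewrite pnatr_eq0.
have X3 : X ^+ 3 = 1 by rewrite (rhoX3 rhoP) h0.
apply: (mulfI nz4); rewrite mulrCA pairs_T mulrDr mulrCA T0_jacobi sumT_jacobi.
rewrite /s3 !big_cons !big_nil /noncube_coef -!plusE /=.
rewrite !(jacobiSl rhoP) !(jacobiSr rhoP) !(rhoXS rhoP) X3.
have [J1 J2] : (0 < 1 < 3)%N /\ (0 < 2 < 3)%N by [].
rewrite !(jacobi_r3 rhoP J1, jacobi_r3 rhoP J2, jacobi_3r rhoP J1, jacobi_3r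
  rhoP J2).
rewrite (jacobi33 rhoP) (jacobi12 rhoP) (jacobi21 rhoP); ring.
Qed.

End Count.

End SplitResolvent.

(** * The quadratic extension: q = 2 mod 3 *)

Lemma pchar_card (F : finFieldType) (p : nat) : p \in [pchar F] -> p.-nat #|F|.
Proof. by move=> pF; rewrite -cardsT;
  apply/abelem_pgroup/fin_ring_pchar_abelem. Qed.

Lemma dvd3_card (F : finFieldType) : (3 %| #|F|)%N = (3%:R == 0 :> F).
Proof.
apply/idP/idP => [d3 | z3].
  have [p _ pF] := finPcharP F.
  have := pnat_dvd d3 (pchar_card pF); rewrite pnatE // inE => /eqP p3.
  by case/andP: pF; rewrite -p3.
have /p_natP[[|n] cF] : 3%N.-nat #|F| by apply: pchar_card; apply/andP.
  by have := finNzRing_gt1 F; rewrite cF.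
by rewrite cF expnS dvdn_mulr.
Qed.

Lemma exprD_card (F K : finFieldType) (iota : {rmorphism F -> K}) (x y : K) :
  (x + y) ^+ #|F| = x ^+ #|F| + y ^+ #|F|.
Proof.
apply: exprDn_pchar; have [p _ pF] := finPcharP F.
by apply: sub_in_pnat (pchar_card pF) => n _; rewrite inE => /eqP ->;
  rewrite (fmorph_pchar iota).
Qed.

(** Adjoin a root of Z^2 + Z + 1. A root x in F would satisfy x^3 = 1, hence x = x^q = x^2 and x =
    1, which forces 3 = 0. *)
Lemma quadratic_extension_exists (F : finFieldType) : #|F| = 2 %[mod 3] ->
  exists (K : finFieldType) (iota : {rmorphism F -> K}), #|K| = (#|F| ^ 2)%N.
Proof.
move=> q2; pose p : {poly F} := Poly [:: 1; 1; 1].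
have pE : p = [:: 1; 1; 1] :> seq F by apply: (@PolyK _ 0); rewrite /= oner_eq0.
have sp : size p = 3 by rewrite pE.
have nr x : ~~ root p x.
  apply/negP; rewrite /root horner_Poly /= => /eqP E.
  have x3 : x ^+ 3 = 1.
    by apply/eqP; rewrite -subr_eq0 -(mulr0 (x - 1)) -E; apply/eqP; ring.
  have xq : x ^+ 2 = x.
    rewrite -[RHS]expf_card (divn_eq #|F| 3) q2 exprD mulnC exprM x3 expr1n
      mul1r.
    by [].
  have x0 : x != 0.
    by apply/eqP => x0; move/esym/eqP: x3; rewrite x0 expr0n oner_eq0.
  have x1 : x = 1 by apply: (mulfI x0); rewrite mulr1 -expr2.
  have nz3 : 3%:R = 0 :> F by rewrite -E x1; ring.
  by move/eqP: nz3; rewrite -dvd3_card /dvdn q2.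
have irr : irreducible_poly p by apply: cubic_irreducible; rewrite ?sp.
have mi : monic_irreducible_poly p.
  by split=> //; rewrite monicE lead_coefE pE.
exists {poly %/ p with mi}, (qfpoly_const mi).
by rewrite card_qfpoly sp.
Qed.

Lemma card_poly_roots (F : finFieldType) (p : {poly F}) :
  p != 0 -> (#|[set x | root p x]| < size p)%N.
Proof.
move=> p0; rewrite cardE; apply: max_poly_roots => //; last exact: enum_uniq.
by apply/allP => x; rewrite mem_enum inE.
Qed.

Section QuadraticExtension.

Variables (F K : finFieldType) (iota : {rmorphism F -> K}).
Hypotheses (cardK : #|K| = (#|F| ^ 2)%N) (q2 : #|F| = 2 %[mod 3]).
Variable rho : K -> algC.
Hypothesis rhoP : cubic_character rho.
Implicit Types (c t s : F) (a b d u x : K).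

Local Notation q := (#|F|).
Local Notation qC := (q%:R : algC).

Let q1 : (1 < q)%N := finNzRing_gt1 F.

Let qE : exists k, q = (3 * k).+2.
Proof. by exists (q %/ 3)%N; rewrite {1}(divn_eq q 3) q2 mulnC addn2. Qed.

Let exprDq a b : (a + b) ^+ q = a ^+ q + b ^+ q.
Proof. exact: exprD_card iota a b. Qed.

Let exprqq a : (a ^+ q) ^+ q = a.
Proof. by rewrite -exprM mulnn -cardK expf_card. Qed.

Let iotaq c : iota c ^+ q = iota c.
Proof. by rewrite -rmorphXn expf_card. Qed.

Let exprNq a : (- a) ^+ q = - a ^+ q.
Proof.
by rewrite -mulN1r exprMn -[-1 : K](rmorphN1 iota) iotaq rmorphN1 mulN1r.
Qed.

(** Evaluate at [x] the factorisation of X^q - X into the X - c with c in F. *)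
Let fixed_iota x : x ^+ q = x -> exists c, x = iota c.
Proof.
move=> xq; have := congr1 (map_poly iota) (finField_genPoly F).
move/(congr1 (fun p => p.[x]));
  rewrite rmorphB rmorph_prod /= map_polyXn map_polyX.
rewrite hornerD hornerN hornerXn hornerX xq subrr horner_prod =>
  /esym/eqP/prodf_eq0.
case=> c _; rewrite rmorphB /= map_polyX map_polyC hornerXsubC subr_eq0 => /eqP
  ->.
by exists c.
Qed.

(** For q = 3k + 2 one has 3(2k + 1) = 2(q - 1) + 1, so the power 2k + 1 inverts cubing. *)
Let cbrt_exists : exists2 f : F -> F, cancel f (fun t => t ^+ 3) & cancel (fun
  t => t ^+ 3) f.
Proof.
have [k qk] := qE; exists (fun t => t ^+ (2 * k).+1) => t.
  rewrite -exprM; have -> : ((2 * k).+1 * 3 = q + q.-1)%N by rewrite qk /=; lia.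
  have [->|t0] := eqVneq t 0; first by rewrite expr0n qk.
  apply: (mulfI t0); rewrite exprD mulrCA -exprS prednK ?(ltnW q1) // expf_card.
  by [].
rewrite -exprM; have -> : (3 * (2 * k).+1 = q + q.-1)%N by rewrite qk /=; lia.
have [->|t0] := eqVneq t 0; first by rewrite expr0n qk.
by apply: (mulfI t0);
  rewrite exprD mulrCA -exprS prednK ?(ltnW q1) // expf_card.
Qed.

Let tr_exists : exists tr : K -> F, forall a, iota (tr a) = a + a ^+ q.
Proof.
apply: (@fin_all_exists K (fun=> F) (fun a c => iota c = a + a ^+ q)) => a.
have [|c ->] := @fixed_iota (a + a ^+ q); last by exists c.
by rewrite exprDq exprqq addrC.
Qed.

(** [nm] is the cube root in F of the norm, not the norm itself: it recovers t from the product t^3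
    of the roots of the resolvent. *)
Let nm_exists : exists nm : K -> F, forall a, iota (nm a ^+ 3) = a ^+ q.+1.
Proof.
have [f fK _] := cbrt_exists.
apply: (@fin_all_exists K (fun=> F) (fun a t => iota (t ^+ 3) = a ^+ q.+1)) =>
  a.
have [|c E] := @fixed_iota (a ^+ q.+1); last by exists (f c); rewrite fK -E.
by rewrite -exprM mulSn exprD mulnn -cardK expf_card -exprSr.
Qed.

Let rhoXq x : rho x ^+ q = rho x ^+ 2.
Proof.
have [k ->] := qE; elim: k => [|k IHk]; first by [].
by rewrite mulnS (rhoXS rhoP) IHk.
Qed.

Let rho_iota c : c != 0 -> rho (iota c) = 1.
Proof.
move=> c0; have [f fK _] := cbrt_exists.
rewrite -[c]fK rmorphXn (rho_cube rhoP) // fmorph_eq0.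
by apply: contraNneq c0 => f0; rewrite -[c]fK f0 expr0n.
Qed.

Section TraceNorm.

Variables (tr nm : K -> F).
Hypotheses (trE : forall a, iota (tr a) = a + a ^+ q)
           (nmE : forall a, iota (nm a ^+ 3) = a ^+ q.+1).

Let trD a b : tr (a + b) = tr a + tr b.
Proof.
by apply: (fmorph_inj iota); rewrite rmorphD !trE exprDq; ring.
Qed.

Let tr_scale c a : tr (iota c * a) = c * tr a.
Proof.
by apply: (fmorph_inj iota); rewrite rmorphM !trE exprMn iotaq mulrDr.
Qed.

Let nm_eq a b : (nm a == nm b) = (a ^+ q.+1 == b ^+ q.+1).
Proof.
rewrite -!nmE (inj_eq (fmorph_inj iota)).
by have [f _ fK] := cbrt_exists; rewrite (inj_eq (can_inj fK)).
Qed.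

Let w t c : nat := (\sum_a [&& ~~ cube a, tr a == c & nm a == t])%N.

Let w_le t c : (w t c <= 2 * noroot t c)%N.
Proof.
have quad a : tr a = c -> nm a = t -> a ^+ 2 - iota c * a + iota t ^+ 3 = 0.
  by move=> <- <-; rewrite trE -rmorphXn nmE [a ^+ q.+1]exprS; ring.
rewrite /w; case: (boolP (noroot t c)) => [_|]; last first.
  rewrite negb_forall => /existsP[x]; rewrite negbK => /eqP xc.
  rewrite big1 ?muln0 // => a _; apply/eqP; rewrite eqb0.
  apply/negP => /and3P[nca /eqP tra /eqP nma].
  case/negP: nca; apply: (@resolvent_root_cube _ a (iota t) (iota x)).
  by rewrite -rmorphXn -rmorphM -rmorphMn -rmorphB xc quad.
apply: leq_trans (card_quadratic_roots (iota c) (iota t ^+ 3)).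
rewrite -sum1_card [leqRHS]big_mkcond leq_sum // => a _; rewrite inE.
by case: and3P => // -[_ /eqP tra /eqP nma]; rewrite quad // eqxx.
Qed.

Let noncubes : (3 * (\sum_(a : K) ~~ cube a) = 2 * (q ^ 2).-1)%N.
Proof.
apply/eqP; rewrite -(eqr_nat algC) !natrM natr_sum (sum_noncube rhoP).
by rewrite -subn1 natrB ?cardK // expn_gt0 ltnW.
Qed.

Let w_sum : (3 * (\sum_t \sum_c w t c) = 2 * (q ^ 2).-1)%N.
Proof.
rewrite -noncubes; congr muln.
under eq_bigr => t _ do rewrite exchange_big.
rewrite exchange_big; apply: eq_bigr => a _ /=.
under eq_bigr => t _ do under eq_bigr => c _ do rewrite andbCA -mulnb.
under eq_bigr => t _ do rewrite -big_distrl /= sum_deltan mul1n -mulnb.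
by rewrite -big_distrr /= sum_deltan muln1.
Qed.

Let nz3 : 3%:R != 0 :> F.
Proof. by rewrite -dvd3_card /dvdn q2. Qed.

Let w_noroot : forall t c, w t c = (2 * noroot t c)%N.
Proof. exact: noroot_weight. Qed.

Section Count.

Variable h : F.
Hypothesis h0 : h != 0.

Let nc a : algC := (~~ cube a)%:R.

Let pairs_ab : 4%:R * (noroot_pairs h)%:R
  = \sum_a \sum_b nc a * nc b * ((nm a == nm b) && (tr b == tr a + h))%:R.
Proof.
transitivity ((\sum_t \sum_c w t c * w t (c + h)%R)%N%:R : algC).
  rewrite -natrM /noroot_pairs big_distrr; congr _%:R; apply: eq_bigr => t _.
  rewrite big_distrr; apply: eq_bigr => c _; rewrite !w_noroot.
  by do 2!case: noroot.
transitivity (\sum_t \sum_c \sum_a \sum_b nc a * nc b *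
    ((nm a == t)%:R * ((tr a == c)%:R * ((nm b == t) && (tr b == c + h))%:R))).
  rewrite natr_sum; apply: eq_bigr => t _; rewrite natr_sum;
    apply: eq_bigr => c _.
  rewrite natrM /w !natr_sum big_distrlr; apply: eq_bigr => a _;
    apply: eq_bigr => b _ /=.
  by rewrite /nc -!mulnb !natrM; ring.
under eq_bigr => t _ do rewrite exchange_big.
rewrite exchange_big; apply: eq_bigr => a _ /=.
under eq_bigr => t _ do rewrite exchange_big.
rewrite exchange_big; apply: eq_bigr => b _ /=.
under eq_bigr => t _ do rewrite -big_distrr -big_distrr /= sum_delta.
by rewrite -big_distrr /= sum_delta eq_sym.
Qed.

Let tr0 : tr 0 = 0.
Proof. by apply: (fmorph_inj iota);
  rewrite trE rmorph0 expr0n gtn_eqF ?addr0 // ltnW. Qed.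

(** Equal norms mean b = a u with u of norm 1, and the trace condition becomes tr(d) = h for d = a(u
    - 1). The value u = 1 would give h = 0. *)
Let pairs_ud : 4%:R * (noroot_pairs h)%:R
  = \sum_(u | u != 1) \sum_d nc (d / (u - 1)) * nc (d * u / (u - 1))
       * ((u ^+ q.+1 == 1) && (tr d == h))%:R.
Proof.
rewrite pairs_ab.
transitivity (\sum_a \sum_u nc a * nc (a * u)
    * ((u ^+ q.+1 == 1) && (tr (a * (u - 1)) == h))%:R).
  apply: eq_bigr => a _; rewrite /nc;
    case: (boolP (cube a)) => [_|/noncube_neq0 a0].
    by rewrite !big1 // => b _; rewrite !mul0r.
  rewrite (reindex_inj (mulfI a0)); apply: eq_bigr => u _ /=;
    congr (_ * (_ && _)%:R).
    rewrite nm_eq exprMn -{1}[a ^+ _]mulr1 (inj_eq (mulfI _)) ?expf_neq0 //.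
  have -> : a * u = a * (u - 1) + a by ring.
  by rewrite trD addrC (inj_eq (addrI _)).
rewrite exchange_big (bigD1 1) //= big1 ?add0r => [|a _]; last first.
  by rewrite subrr mulr0 tr0 [0 == h]eq_sym (negPf h0) andbF mulr0.
apply: eq_bigr => u u1; rewrite -subr_eq0 in u1.
rewrite (reindex_inj (mulIf (invr_neq0 u1))); apply: eq_bigr => d _ /=.
by rewrite divfK // [d / _ * u]mulrAC.
Qed.

(** An Eisenstein sum, taken over the elements of trace [h]. *)
Let A n : algC := \sum_d (tr d == h)%:R * rho d ^+ n.
Let U n : algC := \sum_(u | u != 1) (u ^+ q.+1 == 1)%:R * rho u ^+ n.

(* u (u - 1)^q = - (u - 1) when u has norm 1. *)
Let rho_sub1 u : u != 1 -> u ^+ q.+1 = 1 -> rho (u - 1)^-1 = rho u.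
Proof.
move=> u1 nu; rewrite (rhoV rhoP).
have E : u * (u - 1) ^+ q = - (u - 1).
  by rewrite exprDq exprNq expr1n mulrDr -exprS nu; ring.
have := congr1 rho E;
  rewrite (rhoN rhoP) (rhoM rhoP) -(prednK (ltnW q1)) (rhoXn rhoP).
rewrite prednK ?(ltnW q1) // rhoXq => E'.
rewrite expr2 -{2}E' mulrCA -exprS (rhoX3 rhoP) subr_eq0 u1 mulr1 //.
Qed.

Local Notation m := noncube_coef.
Let s3 : seq nat := [:: 1; 2; 3]%N.

Let ncE a : nc a = (\sum_(i <- s3) m i * rho a ^+ i) / 3%:R.
Proof. exact: noncube_sum. Qed.

(** By [rho_sub1], the arguments d / (u - 1) and d u / (u - 1) have characters rho(d) rho(u) and
    rho(d) rho(u)^2; hence the exponents i + j for d and i + 2j for u. *)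
Let pairs_AU : 36%:R * (noroot_pairs h)%:R
  = \sum_(i <- s3) \sum_(j <- s3) m i * m j * (A (i + j) * U (i + j + j)).
Proof.
have -> : 36%:R * (noroot_pairs h)%:R = 9%:R * (4%:R * (noroot_pairs h)%:R) :>
  algC by ring.
rewrite pairs_ud big_distrr.
transitivity (\sum_(u | u != 1) \sum_d \sum_(i <- s3) \sum_(j <- s3) m i * m j *
   (((tr d == h)%:R * rho d ^+ (i + j)) * ((u ^+ q.+1 == 1)%:R * rho u ^+ (i +
     j + j)))).
  apply: eq_bigr => u u1; rewrite big_distrr; apply: eq_bigr => d _ /=.
  have [nu|_] /= := eqVneq (u ^+ q.+1) 1; last first.
    rewrite !mulr0 big1 // => i _; rewrite big1 // => j _.
    by rewrite mul0r !mulr0.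
  rewrite !ncE !(rhoM rhoP) rho_sub1 //.
  set S1 := \sum_(i <- s3) _; set S2 := \sum_(i <- s3) _.
  transitivity ((tr d == h)%:R * (S1 * S2)); first by field.
  rewrite big_distrlr big_distrr; apply: eq_bigr => i _; rewrite big_distrr;
    apply: eq_bigr => j _.
  rewrite /= !exprMn !exprD; ring.
under eq_bigr => u _ do rewrite exchange_big.
rewrite exchange_big; apply: eq_bigr => i _.
under eq_bigr => u _ do rewrite exchange_big.
rewrite exchange_big; apply: eq_bigr => j _ /=.
rewrite [A _ * _]mulrC big_distrlr big_distrr; apply: eq_bigr => u _.
rewrite big_distrr; apply: eq_bigr => d _ /=; ring.
Qed.

(** [rho] is trivial on the nonzero elements of F, so scaling by c / h changes the trace without
    changing the summands. *)
Let A_eq n c : (0 < n)%N -> c != 0 ->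
  \sum_d (tr d == c)%:R * rho d ^+ n = A n.
Proof.
move=> n0 c0; have e0 : iota (c / h) != 0 by rewrite fmorph_eq0 mulf_neq0
  ?invr_eq0.
rewrite (reindex_inj (mulfI e0)); apply: eq_bigr => d _ /=.
rewrite tr_scale (rhoM rhoP) rho_iota ?mulf_neq0 ?invr_eq0 // mul1r.
congr ((nat_of_bool _)%:R * _).
rewrite -[X in _ == X]mulr1 -mulrA (inj_eq (mulfI c0)) mulrC.
by rewrite (can2_eq (divfK h0) (mulfK h0)) mul1r.
Qed.

(** Each fibre consists of roots of X^q + X - c, so has at most q elements; the fibres fill K, of
    size q^2. *)
Let card_tr c : #|[set d | tr d == c]| = q.
Proof.
pose u c := #|[set d | tr d == c]|.
suff H : u =1 (fun=> q) by exact: H.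
apply: sum_squeeze => [s|]; last first.
  rewrite sum_nat_const mulnn -cardK -sum1_card (partition_big tr predT) //=.
  by apply: eq_leq; apply: eq_bigr => s _; rewrite sum1dep_card.
pose p : {poly K} := 'X^q + ('X - (iota s)%:P).
have sp : size p = q.+1.
  by rewrite size_polyDl size_polyXn // size_XsubC.
rewrite -ltnS -sp; apply: leq_ltn_trans (card_poly_roots _); last first.
  by rewrite -size_poly_eq0 sp.
apply/subset_leq_card/subsetP => d; rewrite !inE => /eqP trd.
by rewrite /root /p -trd hornerD hornerXn hornerXsubC trE; apply/eqP; ring.
Qed.

Let A3 : A 3 = qC.
Proof.
rewrite -(card_tr h) -sum1_card natr_sum [RHS]big_mkcond; apply: eq_bigr => d _.
rewrite inE (rhoX3 rhoP); case: eqP => [trd|_] /=; last by rewrite mul0r.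
rewrite mul1r; suff -> : d != 0 by [].
by apply: contraNneq h0 => d0; rewrite -trd d0 tr0.
Qed.

(** The sum over all of K vanishes, and each nonzero trace contributes [A n] by [A_eq]. On the
    kernel of the trace d^q = -d, so rho(d)^2 = rho(d) and the q - 1 nonzero elements contribute 1
    each. *)
Let A12 n : (0 < n < 3)%N -> A n = -1.
Proof.
move=> n_range; have n0 : (0 < n)%N by case/andP: n_range.
have qC1 : qC - 1 != 0 by rewrite subr_eq0 (eqr_nat _ _ 1) gtn_eqF.
have kerE : \sum_d (tr d == 0)%:R * rho d ^+ n = qC - 1.
  rewrite -(card_tr 0) -sum1_card natr_sum [X in _ = X - 1](bigD1 0) ?inE ?tr0
    //= [RHS]addrC addKr.
  rewrite (bigD1 0) //= tr0 eqxx (rho0 rhoP) expr0n gtn_eqF // mulr0 add0r.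
  rewrite [LHS]big_mkcond [RHS]big_mkcond; apply: eq_bigr => d _; rewrite inE.
  case: (eqVneq d 0) => [->|d0]; rewrite ?andbF // andbT.
  case: eqP => [trd|_]; last by rewrite mul0r.
  have : iota (tr d) = 0 by rewrite trd rmorph0.
  rewrite trE addrC => /eqP; rewrite addr_eq0 => /eqP dq.
  have := rhoXq d.
  rewrite -(prednK (ltnW q1)) -(rhoXn rhoP) prednK ?(ltnW q1) // dq (rhoN rhoP)
    => E.
  have rd0 : rho d != 0.
    by apply/eqP => rd; have := rhoX3 rhoP d;
      rewrite rd d0 expr0n => /esym/eqP; rewrite oner_eq0.
  have -> : rho d = 1 by apply: (mulfI rd0); rewrite mulr1 -expr2 -E.
  by rewrite expr1n mulr1.
have : \sum_c \sum_d (tr d == c)%:R * rho d ^+ n = 0.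
  rewrite exchange_big -[RHS](sum_rhoX rhoP n_range); apply: eq_bigr => d _ /=.
  by rewrite (sum_delta (tr d) (fun=> rho d ^+ n)).
rewrite (bigD1 0) //= kerE (eq_bigr (fun=> A n)); last by move=> c c0;
  rewrite A_eq.
rewrite sumr_const cardC1 -[A n *+ _]mulr_natl -subn1 natrB ?(ltnW q1) // =>
  /eqP.
rewrite -{1}[qC - 1]mulr1 -mulrDr mulf_eq0 (negPf qC1) addrC addr_eq0 => /eqP
  //.
Qed.

Let V n : algC := \sum_u (u ^+ q.+1 == 1)%:R * rho u ^+ n.

Let UV n : U n = V n - 1.
Proof.
by rewrite /V (bigD1 1) //= expr1n eqxx (rho1 rhoP) expr1n mulr1 [RHS]addrC
  addKr.
Qed.

(** For a non-cube g, the element g^(q - 1) has norm 1 and the same character value as g, because q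
    - 1 = 1 modulo 3; multiplying by it rescales the sum. *)
Let V12 n : (0 < n < 3)%N -> V n = 0.
Proof.
move=> n_range; case: (rhoP) => _ _ _ _ [g ncg]; have g0 := noncube_neq0 ncg.
have [k qk] := qE.
pose e := g ^+ q.-1.
have e0 : e != 0 by rewrite expf_neq0.
have re : rho e = rho g.
  rewrite /e qk /= (rhoXn rhoP); elim: (k) => // j IHj;
    rewrite mulnS (rhoXS rhoP) //.
have ne : e ^+ q.+1 = 1.
  apply: (mulfI g0); rewrite mulr1 -exprM -exprS -[RHS]expf_card cardK.
  congr (_ ^+ _); rewrite -mulnn; lia.
have : V n = rho g ^+ n * V n.
  rewrite {1}/V (reindex_inj (mulfI e0)) big_distrr; apply: eq_bigr => u _ /=.
  by rewrite exprMn ne mul1r (rhoM rhoP) re exprMn mulrCA.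
move/eqP; rewrite -subr_eq0 -{1}[V n]mul1r -mulrBl mulf_eq0 subr_eq0 eq_sym.
have rg1 : rho g != 1 by rewrite (rho_eq1 rhoP).
suff /negPf -> : rho g ^+ n != 1 by move/eqP.
case: n n_range => [|[|[|]]] // _.
apply: contraNneq rg1 => rg2.
by have := rhoX4 rhoP g; rewrite (exprM _ 2 2) rg2 expr1n => <-.
Qed.

(** X^(q + 1) - c has at most q + 1 roots, and only the root 0 for c = 0; since (q - 1)(q + 1) + 1 =
    q^2 exhausts K, the bounds are attained. *)
Let card_nm c : c != 0 -> #|[set u | u ^+ q.+1 == iota c]| = q.+1.
Proof.
pose u c := #|[set d | d ^+ q.+1 == iota c]|.
pose v (c : F) := if c == 0 then 1%N else q.+1.
move=> c0; suff H : u =1 v by rewrite [LHS]H /v (negPf c0).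
have uE s : u s = #|[set d | nm d ^+ 3 == s]|.
  by apply: eq_card => d; rewrite !inE -nmE (inj_eq (fmorph_inj iota)).
apply: sum_squeeze => [s|]; last first.
  have -> : (\sum_s v s = q ^ 2)%N.
    rewrite (bigD1 0) //= /v eqxx (eq_bigr (fun=> q.+1)) => [|s /negPf-> //].
    by rewrite sum_nat_const cardC1 -mulnn; case: q q1 => //= k _; lia.
  rewrite -cardK -sum1_card (partition_big (fun d => nm d ^+ 3) predT) //=.
  by apply: eq_leq; apply: eq_bigr => s _; rewrite uE sum1dep_card.
rewrite /v; case: eqVneq => [->|s0].
  rewrite -(cards1 (0 : K)); apply/subset_leq_card/subsetP => d.
  by rewrite !inE rmorph0 expf_eq0.
rewrite -ltnS -(@size_XnsubC _ q.+1 (iota s)) //.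
apply: leq_ltn_trans (card_poly_roots _); last first.
  by rewrite -size_poly_eq0 size_XnsubC.
apply/subset_leq_card/subsetP => d; rewrite !inE => /eqP E.
by rewrite /root !hornerE E subrr.
Qed.

Let V3 : V 3 = qC + 1.
Proof.
rewrite natr1 -(card_nm (oner_neq0 F)) -sum1_card natr_sum [RHS]big_mkcond.
apply: eq_bigr => u _; rewrite inE rmorph1 (rhoX3 rhoP).
case: eqP => [nu|_] /=; last by rewrite mul0r.
rewrite mul1r; suff -> : u != 0 by [].
by apply/eqP => u0; move/esym/eqP: nu; rewrite u0 expr0n oner_eq0.
Qed.

(** After reduction of the exponents, [A] and [U] both take the value -1 at 1 and 2, and q at 3. *)
Lemma noroot_pairs_trace_norm :
  9%:R * (noroot_pairs h)%:R = qC ^+ 2 - qC - 2%:R :> algC.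
Proof.
have nz4 : 4%:R != 0 :> algC by rewrite pnatr_eq0.
apply: (mulfI nz4); transitivity (36%:R * (noroot_pairs h)%:R : algC);
  first by ring.
have AS n : A n.+4 = A n.+1 by apply: eq_bigr => d _; rewrite (rhoXS rhoP).
have US n : U n.+4 = U n.+1 by apply: eq_bigr => u _; rewrite (rhoXS rhoP).
have [i1 i2] : (0 < 1 < 3)%N /\ (0 < 2 < 3)%N by [].
rewrite pairs_AU /s3 !big_cons !big_nil /noncube_coef -!plusE /= !AS !US.
rewrite !(A12 i1) !(A12 i2) A3 !UV !(V12 i1) !(V12 i2) V3; ring.
Qed.

End Count.

End TraceNorm.

Lemma noroot_pairs_quadratic (h : F) : h != 0 ->
  9%:R * (noroot_pairs h)%:R = qC ^+ 2 - qC - 2%:R :> algC.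
Proof.
move=> h0; have [[tr trE] [nm nmE]] := (tr_exists, nm_exists).
exact: (noroot_pairs_trace_norm trE nmE h0).
Qed.

End QuadraticExtension.

(** * Characteristic 3 *)

Section CharacteristicThree.

Variable F : finFieldType.
Hypothesis z3 : 3%:R = 0 :> F.
Implicit Types a b c d e h k m s x y : F.

Let cubeD x y : (x + y) ^+ 3 = x ^+ 3 + y ^+ 3.
Proof.
transitivity (x ^+ 3 + y ^+ 3 + 3%:R * (x ^+ 2 * y + x * y ^+ 2));
  first by ring.
by rewrite z3 mul0r addr0.
Qed.

Let cubeN x : (- x) ^+ 3 = - x ^+ 3.
Proof. by ring. Qed.

Let cube_inj : injective (fun x : F => x ^+ 3).
Proof.
move=> x y /= E; apply/eqP; rewrite -subr_eq0 -[_ == 0](expf_eq0 _ 3).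
by rewrite cubeD cubeN E subrr.
Qed.

Let opp_neq x : x != 0 -> x != - x.
Proof.
move=> x0; rewrite -addr_eq0.
have -> : x + x = 3%:R * x - x by ring.
by rewrite z3 mul0r sub0r oppr_eq0.
Qed.

(* x -> d x^3 + e x is additive, so it is onto as soon as its kernel is
  trivial. *)
Let additive_cubic_surj d e y :
  (forall x, d * x ^+ 3 + e * x = 0 -> x = 0) -> exists x, d * x ^+ 3 + e * x =
    y.
Proof.
move=> ker; have inj : injective (fun x => d * x ^+ 3 + e * x).
  move=> x1 x2 /= E; apply/eqP; rewrite -subr_eq0; apply/eqP/ker.
  by rewrite cubeD cubeN !mulrDr !mulrN addrACA E -opprD subrr.
by have /codomP[x ->] := injF_onto inj y; exists x.
Qed.

Definition artin_schreier m : bool := [exists x, x ^+ 3 - x == m].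

Local Notation n m := (~~ artin_schreier m).

Let n_neq0 m : n m -> m != 0.
Proof.
by apply: contraNneq => ->; apply/existsP; exists 0; rewrite expr0n subrr.
Qed.

Let n_opp m : n (- m) = n m.
Proof.
have imp x : artin_schreier x -> artin_schreier (- x).
  case/existsP=> y /eqP <-; apply/existsP; exists (- y); apply/eqP; ring.
by congr negb; apply/idP/idP => /imp //; rewrite opprK.
Qed.

Local Notation N := (\sum_m n m)%N.

(** The fibres of x -> x^3 - x are the cosets {y, y + 1, y - 1} of the prime field, so its image has
    q / 3 elements. *)
Let N_card : (3 * N = 2 * #|F|)%N.
Proof.
have fib m : (\sum_(x : F) (x ^+ 3 - x == m)%R = 3 * artin_schreier m)%N.
  case: (boolP (artin_schreier m)) => [/existsP[y /eqP ym]|]; last first.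
    rewrite negb_exists => /forallP H; rewrite big1 // => x _.
    by rewrite (negPf (H x)).
  have E x : (x ^+ 3 - x == m) = (x \in [set y; y + 1; y - 1]).
    rewrite !inE -ym -subr_eq0 -[x == y]subr_eq0 -[x == y + 1]subr_eq0 -[x == y
      - 1]subr_eq0.
    rewrite -!mulf_eq0; congr (_ == 0).
    transitivity (x ^+ 3 + (- y) ^+ 3 - x + y); first by ring.
    by rewrite -cubeD; ring.
  transitivity #|[set y; y + 1; y - 1]|.
    rewrite -sum1_card [RHS]big_mkcond; apply: eq_bigr => x _.
    by rewrite E; case: ifP.
  have y1 : y - 1 != y by rewrite -subr_eq0 addrAC subrr add0r oppr_eq0
    oner_eq0.
  have y2 : y != y + 1 by rewrite -subr_eq0 opprD addrA subrr add0r oppr_eq0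
    oner_eq0.
  have y3 : y - 1 != y + 1.
    by rewrite (inj_eq (addrI y)) eq_sym opp_neq ?oner_eq0.
  by rewrite setUC cardsU1 cards2 !inE (negPf y1) (negPf y3) y2.
have : (\sum_(m : F) \sum_(x : F) (x ^+ 3 - x == m)%R = #|F|)%N.
  rewrite exchange_big (eq_bigr (fun=> 1%N)) ?sum1_card // => x _.
  exact: sum_deltan.
rewrite (eq_bigr _ (fun m _ => fib m)).
rewrite -big_distrr /=.
have : (N + \sum_(m : F) artin_schreier m = #|F|)%N.
  rewrite -big_split (eq_bigr (fun=> 1%N)) ?sum1_card // => m _.
  by case: artin_schreier.
by move=> /= H1 H2; lia.
Qed.

Variable h : F.
Hypothesis h0 : h != 0.

Let rootless_lin s c : s != 0 -> rootless 0 (- s ^+ 2) c = n (c / s ^+ 3).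
Proof.
move=> s0; rewrite -n_opp /rootless -negb_exists; congr negb.
apply/existsP/existsP => -[x /eqP E].
  exists (x / s); have -> : c = s ^+ 2 * x - x ^+ 3.
    by apply/eqP; rewrite -subr_eq0 -E /cubic; apply/eqP; ring.
  by apply/eqP; field.
exists (x * s); have -> : c = - (s ^+ 3 * (x ^+ 3 - x)) by rewrite E; field.
by rewrite /cubic; apply/eqP; ring.
Qed.

(** A nonzero square -b has the two roots s and -s. Otherwise x -> x^3 + bx has trivial kernel, so
    it is onto and every cubic with this [b] has a root. *)
Let rootless_lin_pairs b :
  (2 * rootless_pairs h 0%R b
     = \sum_(s : F | s != 0%R) (- s ^+ 2 == b)%R * rootless_pairs h 0%R b)%N.
Proof.
have [/existsP[s /andP[s0 /eqP bs]] | ] := boolP [exists s : F, (s != 0) && (b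
  == - s ^+ 2)].
  rewrite -big_distrl (bigD1 s) //= (bigD1 (- s)) /=; last first.
    by rewrite oppr_eq0 s0 eq_sym opp_neq.
  rewrite sqrrN bs eqxx big1 // => u /andP[/andP[u0 us] uns].
  by rewrite eqr_opp eqf_sqr (negPf us) (negPf uns).
rewrite negb_exists => /forallP H; rewrite big1 => [|s s0]; last first.
  by have := H s; rewrite s0 /= eq_sym => /negPf ->.
rewrite /rootless_pairs big1 // => c _.
have [x E] : exists x, 1 * x ^+ 3 + b * x = - c.
  apply: additive_cubic_surj => x; rewrite mul1r => E; apply/eqP.
  apply: contraNT (H x) => x0; rewrite x0 /=; apply/eqP/(mulIf x0).
  by apply/eqP; rewrite -subr_eq0 -E; apply/eqP; ring.
have -> // : rootless 0 b c = false.
apply/negbTE/forallPn; exists x; rewrite negbK /cubic mul0r addr0.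
by rewrite -[x ^+ 3]mul1r E addNr.
Qed.

(** For c = -a^3 m^2 with m nonzero, a root x corresponds to y = am / x with y^3 - y = m; the factor
    2 reflects m and -m. *)
Let rootless_quad a c : a != 0 ->
  (2 * rootless a 0%R c = \sum_m n m * (- (a ^+ 3 * m ^+ 2) == c)%R)%N.
Proof.
move=> a0; have a30 := expf_neq0 3 a0.
have rootP m : m != 0 -> rootless a 0 (- (a ^+ 3 * m ^+ 2)) = n m.
  move=> m0; rewrite /rootless -negb_exists; congr negb.
  apply/existsP/existsP => -[x /eqP E].
    have x0 : x != 0.
      apply/eqP => x0; move/eqP: E;
        rewrite /cubic x0 expr0n !mulr0 !expr0n mulr0 !add0r.
      by rewrite oppr_eq0 mulf_eq0 (negPf a30) expf_eq0 (negPf m0).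
    exists (a * m / x); apply/eqP/(mulIf (expf_neq0 3 x0)).
    have x3 : x ^+ 3 = a ^+ 3 * m ^+ 2 - a * x ^+ 2.
      by apply/eqP; rewrite -subr_eq0 -E /cubic; apply/eqP; ring.
    by rewrite [in RHS]x3; field.
  have x0 : x != 0.
    by apply: contraNneq m0 => x0; rewrite -E x0 expr0n subrr.
  exists (a * m / x); by rewrite /cubic -E; apply/eqP; field.
have [/existsP[m /eqP cm] | ] := boolP [exists m, c == - (a ^+ 3 * m ^+ 2)].
  have [m0|m0] := eqVneq m 0.
    have c0 : c = 0 by rewrite cm m0 expr0n mulr0 oppr0.
    have -> : rootless a 0 c = false.
      by apply/negbTE/forallPn; exists 0;
        rewrite negbK /cubic c0 expr0n !mulr0 expr0n mulr0 !addr0.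
    rewrite muln0 big1 // => k _;
      rewrite c0 oppr_eq0 mulf_eq0 (negPf a30) expf_eq0 /=.
    by case: eqP => [->|_]; rewrite ?muln0 //= muln1;
      case: (boolP (n 0)) => // /n_neq0; rewrite eqxx.
  rewrite (bigD1 m) //= (bigD1 (- m)) /=; last by rewrite eq_sym opp_neq.
  rewrite big1 ?addn0 => [|k /andP[km knm]]; last first.
    rewrite cm eqr_opp (inj_eq (mulfI a30)) eqf_sqr (negPf km) (negPf knm)
      muln0 //.
  by rewrite sqrrN cm eqxx !muln1 n_opp rootP // addnn mul2n.
rewrite negb_exists => /forallP H; rewrite big1 => [|m _]; last first.
  by have := H m; rewrite eq_sym => /negPf ->; rewrite muln0.
(* The reciprocal substitution T = a / x turns the cubic into this equation; a nonzero kernel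
   element would make -c / a^3 a square. *)
have [x E] : exists x, (- c / a ^+ 3) * x ^+ 3 + (-1) * x = 1.
  apply: additive_cubic_surj => x E; apply/eqP.
  apply: contraNT (H x^-1) => x0; apply/eqP.
  have : - c * x ^+ 2 = a ^+ 3.
    apply: (mulIf x0); apply/eqP; rewrite -subr_eq0 -(mulr0 (a ^+ 3)) -E.
    by apply/eqP; field.
  by move=> <-; field.
have x0 : x != 0.
  by apply/eqP => x0; move/esym/eqP: E; rewrite x0 expr0n !mulr0 addr0 oner_eq0.
have -> // : rootless a 0 c = false.
apply/negbTE/forallPn; exists (a / x); rewrite negbK /cubic; apply/eqP.
apply: (mulIf (expf_neq0 3 x0)); rewrite !mul0r.
transitivity (a ^+ 3 * (1 - ((- c / a ^+ 3) * x ^+ 3 + (-1) * x)));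
  first by field; apply/andP.
by rewrite E subrr mulr0.
Qed.

(** For b = -s^2, dividing the constant terms by s^3 gives the gap h / s^3, which runs once over all
    nonzero k. Adding k = 0, worth [N], completes the sum to all pairs. *)
Let linear_part : (2 * (\sum_b rootless_pairs h 0%R b) + N = N ^ 2)%N.
Proof.
have -> : (2 * (\sum_b rootless_pairs h 0%R b)
    = \sum_(s : F | s != 0%R) rootless_pairs h 0%R (- s ^+ 2)%R)%N.
  rewrite big_distrr (eq_bigr _ (fun b _ => rootless_lin_pairs b)) exchange_big.
  apply: eq_bigr => s _ /=;
    rewrite (bigD1 (- s ^+ 2)) //= eqxx mul1n big1 ?addn0 // => b.
  by rewrite eq_sym => /negPf ->.
have -> : (\sum_(s : F | s != 0%R) rootless_pairs h 0%R (- s ^+ 2)%R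
    = \sum_(k : F | k != 0%R) \sum_c n c * n (c + k)%R)%N.
  pose f k := h / k ^+ 3.
  have f_inj : injective f by move=> x y /(mulfI h0)/invr_inj/cube_inj.
  rewrite [RHS](reindex_inj f_inj); apply: eq_big => [s|s s0].
    by rewrite /f mulf_eq0 invr_eq0 expf_eq0 (negPf h0).
  rewrite /rootless_pairs (reindex_inj (mulIf (expf_neq0 3 s0)));
    apply: eq_bigr => c _ /=.
  by rewrite !rootless_lin // mulrDl mulfK ?expf_neq0 // mulnb.
transitivity (\sum_(k : F) \sum_c n c * n (c + k)%R)%N.
  rewrite [RHS](bigD1 0) //= addnC; congr addn.
  by apply: eq_bigr => c _; rewrite addr0 mulnb andbb.
rewrite exchange_big -mulnn big_distrl; apply: eq_bigr => c _ /=.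
by rewrite -big_distrr [in RHS](reindex_inj (addrI c)).
Qed.

Let sum_cbrt y : (\sum_(x : F) (x ^+ 3 == y)%R = 1)%N.
Proof.
rewrite -[RHS](sum_deltan y) [RHS](reindex_inj cube_inj).
by apply: eq_bigr => x _; rewrite eq_sym.
Qed.

(** A pair (m, k) determines [a] by a^3 (m^2 - k^2) = h, uniquely because cubing is bijective,
    unless k = m or k = -m; those pairs number 2N. *)
Let quadratic_part :
  (4 * (\sum_(a : F | a != 0%R) rootless_pairs h a 0%R) + 2 * N = N ^ 2)%N.
Proof.
have -> : (4 * (\sum_(a : F | a != 0%R) rootless_pairs h a 0%R)
    = \sum_m \sum_k n m * n k * (m ^+ 2 != k ^+ 2)%R)%N.
  transitivity (\sum_(a : F | a != 0%R) \sum_m \sum_k n m * n k *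
      (a ^+ 3 * (m ^+ 2 - k ^+ 2) == h)%R)%N.
    rewrite big_distrr; apply: eq_bigr => a a0 /=.
    rewrite /rootless_pairs big_distrr /=.
    transitivity (\sum_c \sum_m \sum_k n m * n k * ((- (a ^+ 3 * m ^+ 2) == c)%R
        * (- (a ^+ 3 * k ^+ 2) == c + h)%R))%N.
      apply: eq_bigr => c _;
        transitivity (2 * rootless a 0%R c * (2 * rootless a 0%R (c + h)%R))%N.
        by do 2!case: rootless.
      rewrite !rootless_quad // big_distrlr; apply: eq_bigr => m _;
        apply: eq_bigr => k _ /=.
      by rewrite mulnACA.
    rewrite exchange_big; apply: eq_bigr => m _; rewrite exchange_big;
      apply: eq_bigr => k _ /=.
    rewrite -big_distrr; congr muln;
      rewrite /= (bigD1 (- (a ^+ 3 * m ^+ 2))) //= eqxx mul1n.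
    rewrite big1 ?addn0 => [|c]; last by rewrite eq_sym => /negPf ->.
    congr nat_of_bool; rewrite -subr_eq0 -[RHS]subr_eq0; congr (_ == 0); ring.
  rewrite exchange_big; apply: eq_bigr => m _; rewrite exchange_big;
    apply: eq_bigr => k _ /=.
  rewrite -big_distrr; congr muln => /=;
    have [->|mk] := eqVneq (m ^+ 2) (k ^+ 2).
    by rewrite big1 // => a _; rewrite subrr mulr0 eq_sym (negPf h0).
  rewrite -subr_eq0 in mk.
  transitivity (\sum_(a : F) (a ^+ 3 == h / (m ^+ 2 - k ^+ 2))%R)%N;
    last exact: sum_cbrt.
  rewrite [RHS](bigD1 0) //= expr0n [0 == _]eq_sym mulf_eq0 invr_eq0 (negPf h0)
    (negPf mk) add0n.
  by apply: eq_bigr => a _; rewrite (can2_eq (mulfK mk) (divfK mk)).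
have -> : (2 * N = \sum_m \sum_k n m * n k * (m ^+ 2 == k ^+ 2)%R)%N.
  rewrite big_distrr; apply: eq_bigr => m _ /=; case: (boolP (n m)) => [nm|_];
    last first.
    by rewrite big1.
  rewrite (bigD1 m) //= (bigD1 (- m)) /=;
    last by rewrite eq_sym opp_neq // n_neq0.
  rewrite sqrrN eqxx n_opp nm big1 // => k /andP[km knm].
  by rewrite eq_sym eqf_sqr (negPf km) (negPf knm) muln0.
rewrite -big_split -mulnn big_distrlr; apply: eq_bigr => m _ /=.
rewrite -big_split; apply: eq_bigr => k _ /=.
by rewrite -mulnDr; case: eqP; rewrite muln1.
Qed.

Lemma prime_pair_count_char3 :
  (9 * prime_pair_count 3 h + #|F| ^ 2 + 3 * #|F| = #|F| ^ 3)%N.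
Proof.
rewrite prime_pair_count3E (bigD1 0) //=.
have -> : (\sum_(a : F | a != 0%R) \sum_b rootless_pairs h a b
    = #|F| * \sum_(a : F | a != 0%R) rootless_pairs h a 0%R)%N.
  rewrite big_distrr; apply: eq_bigr => a a0 /=.
  rewrite -sum_nat_const; apply: eq_bigr => b _.
  (* Shifting by b / a changes the linear coefficient to b + 2b = 0. *)
  rewrite -[LHS](rootless_pairs_shift (b / a)).
  have mul3 x : x *+ 3 = 0 by rewrite -mulr_natr z3 mulr0.
  congr (rootless_pairs h _ _); first by rewrite mul3 addr0.
  rewrite mul3 addr0 mulrCA divff // mulr1; have := mul3 b.
  by rewrite mulrS.
have := linear_part; have := quadratic_part; have := N_card.
have arith q M X Y : (3 * M = 2 * q -> 4 * X + 2 * M = M ^ 2 -> 2 * Y + M = M ^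
  2 ->
    9 * (Y + q * X) + q ^ 2 + 3 * q = q ^ 3)%N.
  move=> qM; have [k -> ->] : exists2 k, q = (3 * k)%N & M = (2 * k)%N.
    by exists (q %/ 3)%N; lia.
  rewrite -!mulnn expnS -mulnn => HX HY.
  have -> : Y = (2 * (k * k) - k)%N by lia.
  have -> : X = (k * k - k)%N by lia.
  nia.
exact: arith.
Qed.

End CharacteristicThree.

(** * Integer formulas for the residue classes of q modulo 3 *)

Section PrimePairCounts.

Variables (F : finFieldType) (h : F).
Hypothesis h0 : h != 0.

Local Notation p := (Posz (prime_pair_count 3 h)).
Local Notation q := (Posz #|F|).
Local Notation trace g := (1 + q - Posz #|cubic_twist g|).

(** The characters live in [algC] but the theorem concerns any real closed field; identities between
    integers pass from one to the other. *)
Let to_algC (x y : int) : x%:~R = y%:~R :> algC -> x = y.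
Proof. exact: intr_inj. Qed.

Lemma prime_pair_count_mod0 : #|F| = 0 %[mod 3] ->
  9%:Z * p = q ^+ 3 - q ^+ 2 - 3%:Z * q.
Proof.
move=> q0; have /eqP z3 : 3%:R == 0 :> F by rewrite -dvd3_card /dvdn q0.
have /(congr1 Posz) := prime_pair_count_char3 z3 h0.
by rewrite !expnS !expn0 !(PoszD, PoszM) => E; lia.
Qed.

Lemma prime_pair_count_mod1 (rho : F -> algC) :
  #|F| = 1 %[mod 3] -> cubic_character rho ->
  9%:R * p%:~R = q%:~R * (q%:~R ^+ 2 - q%:~R - 6%:R + 2%:R * (rho h + rho h ^+
    2)
    + rho h ^+ 2 * jacobi rho 1 1 ^+ 2 + rho h * jacobi rho 2 2 ^+ 2) :> algC.
Proof.
move=> q1 rhoP; have nz3 : 3%:R != 0 :> F by rewrite -dvd3_card /dvdn q1.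
rewrite prime_pair_count_depressed // -!pmulrn natrM mulrCA.
by rewrite (noroot_pairs_jacobi rhoP nz3 h0).
Qed.

(** Now rho(h) = 1 and the trace is -(J11 + J22), so J11^2 + J22^2 is its square minus 2q by
    [jacobi_norm]. *)
Lemma prime_pair_count_mod1_cube : #|F| = 1 %[mod 3] -> cube h ->
  9%:Z * p = q * (q ^+ 2 + trace (1 : F) ^+ 2 - 3%:Z * q - 2%:Z).
Proof.
move=> q1 ch; have [rho rhoP] := cubic_character_exists q1.
apply: to_algC; have := prime_pair_count_mod1 q1 rhoP.
have -> : rho h = 1 by apply/eqP; rewrite (rho_eq1 rhoP).
have := cubic_twist_jacobi rhoP (oner_neq0 F);
  rewrite (rho1 rhoP) expr1n !mul1r.
have := jacobi_norm rhoP.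
rewrite !(rmorphM, rmorphD, rmorphN, rmorphXn, rmorph1) /= -!pmulrn.
by move=> nJ tE ->; rewrite tE -nJ; ring.
Qed.

(** With X = rho(h) and 1 + X + X^2 = 0, the product of the two traces is X^2 J11^2 + X J22^2 -
    q. *)
Lemma prime_pair_count_mod1_noncube : #|F| = 1 %[mod 3] -> ~~ cube h ->
  9%:Z * p = q * (q ^+ 2 + trace (1 : F) * trace h - 8%:Z).
Proof.
move=> q1 nch; have [rho rhoP] := cubic_character_exists q1.
apply: to_algC; have := prime_pair_count_mod1 q1 rhoP.
have := noncubeE rhoP h; rewrite (rhoX3 rhoP) h0 nch /= => E.
have r2 : rho h ^+ 2 = - 1 - rho h.
  transitivity (2%:R - rho h - 3%:R * ((2%:R * 1 - rho h - rho h ^+ 2) / 3%:R)).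
    by field.
  by rewrite -E; ring.
have := cubic_twist_jacobi rhoP (oner_neq0 F);
  rewrite (rho1 rhoP) expr1n !mul1r.
have := cubic_twist_jacobi rhoP h0; have := jacobi_norm rhoP.
rewrite !(rmorphM, rmorphD, rmorphN, rmorphXn, rmorph1) /= -!pmulrn.
by move=> nJ thE tE ->; rewrite thE tE -nJ r2; ring.
Qed.

Lemma prime_pair_count_mod2 : #|F| = 2 %[mod 3] ->
  9%:Z * p = q ^+ 3 - q ^+ 2 - 2%:Z * q.
Proof.
move=> q2; have nz3 : 3%:R != 0 :> F by rewrite -dvd3_card /dvdn q2.
have [K [iota cardK]] := quadratic_extension_exists q2.
(* F has no cubic character here, but K does, as q^2 = 1 modulo 3. *)
have [|rho rhoP] := @cubic_character_exists K.
  by rewrite cardK -modnXm q2.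
apply: to_algC; have := noroot_pairs_quadratic iota cardK q2 rhoP h0.
rewrite prime_pair_count_depressed // PoszM.
rewrite !(rmorphM, rmorphD, rmorphN, rmorphXn, rmorph1) /= -!pmulrn mulrCA.
by move=> ->; ring.
Qed.

End PrimePairCounts.

Theorem theorem1p4 (R : rcfType) (F : finFieldType) (h : F) (h_neq0 : h <> 0) :
  let q : R := #|F|%:R in
  let p3 : R := (prime_pair_count 3 h)%:R in
  [/\ #|F| = 0 %[mod 3] ->
        p3 = 1 / 9 * q ^+ 3 * (1 - q ^- 1 - 3 * q ^- 2),
      #|F| = 1 %[mod 3] -> is_cube h ->
        p3 = 1 / 9 * q ^+ 3 * (1 + (cq R F ^+ 2 - 3) * q ^- 1 - 2 * q ^- 2),
      #|F| = 1 %[mod 3] -> ~ is_cube h ->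
        p3 = 1 / 9 * q ^+ 3 * (1 + cq R F * cqh R h * q ^- 1 - 8 * q ^- 2)
    & #|F| = 2 %[mod 3] ->
        p3 = 1 / 9 * q ^+ 3 * (1 - q ^- 1 - 2 * q ^- 2)].
Proof.
move=> q p3; have h0 : h != 0 by apply/eqP.
have q_neq0 : q != 0 by rewrite pnatr_eq0 -lt0n ltnW // finNzRing_gt1.
have sqrt_q : Num.sqrt q ^+ 2 = q by rewrite sqr_sqrtr // ler0n.
have toR (x : int) : 9%:Z * Posz (prime_pair_count 3 h) = x -> p3 = x%:~R / 9.
  move/(congr1 (intr : int -> R)); rewrite rmorphM /= -!pmulrn => <-.
  by rewrite mulrC mulKf ?pnatr_eq0.
have cubeP : reflect (is_cube h) (cube h).
  by apply: (iffP existsP) => -[x /eqP]; exists x.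
split=> [q0|q1 /cubeP hc|q1 /(introN cubeP) hnc|q2].
- rewrite (toR _ (prime_pair_count_mod0 h0 q0)).
  rewrite !(rmorphM, rmorphD, rmorphN, rmorphXn, rmorph1) /= -!pmulrn -/q.
  by field.
- rewrite (toR _ (prime_pair_count_mod1_cube h0 q1 hc)) /cq /cqh expr_div_n
  sqrt_q.
  rewrite !(rmorphM, rmorphD, rmorphN, rmorphXn, rmorph1) /= -!pmulrn -/q.
  by field.
- rewrite (toR _ (prime_pair_count_mod1_noncube h0 q1 hnc)) /cq /cqh.
  rewrite [_ / _ * (_ / _)]mulrACA -invfM -expr2 sqrt_q.
  rewrite !(rmorphM, rmorphD, rmorphN, rmorphXn, rmorph1) /= -!pmulrn -/q.
  by field.
- rewrite (toR _ (prime_pair_count_mod2 h0 q2)).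
  rewrite !(rmorphM, rmorphD, rmorphN, rmorphXn, rmorph1) /= -!pmulrn -/q.
  by field.
Qed.
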